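(* Let $T>0$, let $\varepsilon$ be a nonzero real number with $|\varepsilon|<1$, and let $\Omega=\{(x,t): -\pi<x<\pi,\ 0<t<T\}$. Let $\varphi,\psi\in C^2[-\pi,\pi]$ with $\varphi''',\psi'''\in L_2(-\pi,\pi)$ and $\varphi^{(i)}(\pm\pi)=\psi^{(i)}(\pm\pi)=0$ for $i=0,2$. Consider the inverse problem of finding a pair $(u,f)$ with $u\in C^{2,1}_{x,t}(\Omega)$, $f\in C[-\pi,\pi]$, such that $$u_t(x,t)-u_{xx}(x,t)+\varepsilon u_{xx}(-x,t)=f(x),\quad (x,t)\in\Omega,$$ $$u(x,0)=\varphi(x),\quad u(x,T)=\psi(x),\quad x\in[-\pi,\pi],$$ $$u(-\pi,t)=0,\quad u(\pi,t)=0,\quad t\in[0,T].$$ Then a unique solution of this problem exists, and it is given by $$u(x,t)=\varphi(x)+\sum_{k=1}^\infty \frac{1-e^{-(1+\varepsilon)k^2t}}{1-e^{-(1+\varepsilon)k^2T}}\left(\frac{\varphi^{(3)}_{1k}-\psi^{(3)}_{1k}}{k^3}\right)\sin kx-\sum_{k=0}^\infty \frac{1-e^{-(1-\varepsilon)(k+\frac12)^2t}}{1-e^{-(1-\varepsilon)(k+\frac12)^2T}}\left(\frac{\varphi^{(3)}_{2k}-\psi^{(3)}_{2k}}{(k+\frac12)^3}\right)\cos\left(k+\tfrac12\right)x,$$ $$f(x)=-\varphi''(x)+\varepsilon\varphi''(-x)+\sum_{k=1}^\infty \frac{1+\varepsilon}{k}\left(\frac{\varphi^{(3)}_{1k}-\psi^{(3)}_{1k}}{1-e^{-(1+\varepsilon)k^2T}}\right)\sin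 kx-\sum_{k=0}^\infty\frac{1-\varepsilon}{k+\frac12}\left(\frac{\varphi^{(3)}_{2k}-\psi^{(3)}_{2k}}{1-e^{-(1-\varepsilon)(k+\frac12)^2T}}\right)\cos\left(k+\tfrac12\right)x,$$ where $$\varphi^{(3)}_{1k}=\frac1\pi\int_{-\pi}^\pi\varphi'''(x)\cos kx\,dx,\quad \varphi^{(3)}_{2k}=\frac1\pi\int_{-\pi}^\pi\varphi'''(x)\sin\left(k+\tfrac12\right)x\,dx,$$ $$\psi^{(3)}_{1k}=\frac1\pi\int_{-\pi}^\pi\psi'''(x)\cos kx\,dx,\quad \psi^{(3)}_{2k}=\frac1\pi\int_{-\pi}^\pi\psi'''(x)\sin\left(k+\tfrac12\right)x\,dx.$$
   Context: $C^{2,1}_{x,t}(\Omega)$ denotes functions on $\Omega$ that are twice continuously differentiable in $x$ and once continuously differentiable in $t$. A pair $(u,f)$ with $u\in C^{2,1}_{x,t}(\Omega)$, $f\in C[-\pi,\pi]$ satisfying the equation and conditions is called a regular solution.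
   Formalization: A regular solution u is additionally required to be continuous on the closed rectangle [-π,π]×[0,T]; with u only in C^{2,1} of the open Ω, uniqueness fails (φ=ψ=0, f=0: u=0, or u=1 inside Ω and 0 on its boundary). *)

(* Defs.v *)
From HB Require Import structures.
From mathcomp Require Import all_boot all_order all_algebra.
From mathcomp Require Import all_classical all_reals all_analysis.
Set Implicit Arguments. Unset Strict Implicit. Unset Printing Implicit Defensive.
Import Order.TTheory GRing.Theory Num.Theory.
Import numFieldNormedType.Exports.
Local Open Scope classical_set_scope.
Local Open Scope ring_scope.

Section Defs.
Variable R : realType.

Definition Omega (T : R) : set (R * R) :=
  [set p | -pi < p.1 < pi /\ 0 < p.2 < T].
Definition Omega_bar (T : R) : set (R * R) :=
  [set p | -pi <= p.1 <= pi /\ 0 <= p.2 <= T].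

(* f is in C^2[a,b] with first and second derivatives f1, f2 :
   f is differentiable twice on ]a,b[ (f' = f1, f1' = f2) and
   f, f1, f2 are continuous on [a,b] (f1 a, f2 a, ... are the one-sided
   continuous extensions). *)
Definition C2_on (a b : R) (f f1 f2 : R -> R) : Prop :=
  (forall x, a < x < b -> is_derive x 1 f (f1 x) /\ is_derive x 1 f1 (f2 x)) /\
  {within `[a, b], continuous f} /\
  {within `[a, b], continuous f1} /\
  {within `[a, b], continuous f2}.

(* f2 has a derivative f3 in L_2(a,b), in the usual Sobolev sense:
   f3 is Lebesgue measurable and square-integrable on [a,b], and
   f2 is the indefinite (Lebesgue) integral of f3. *)
Definition deriv_L2 (a b : R) (f2 f3 : R -> R) : Prop :=
  measurable_fun `[a, b] f3 /\
  (\int[@lebesgue_measure R]_(x in `[a, b]) ((f3 x) ^+ 2)%:E < +oo)%E /\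
  (forall x, a <= x <= b ->
     f2 x = f2 a + \int[@lebesgue_measure R]_(y in `[a, x]) f3 y).

Definition fcoef1 (g : R -> R) (k : nat) : R :=
  pi^-1 * \int[@lebesgue_measure R]_(x in `[-pi, pi]) (g x * cos (k%:R * x)).
Definition fcoef2 (g : R -> R) (k : nat) : R :=
  pi^-1 * \int[@lebesgue_measure R]_(x in `[-pi, pi])
            (g x * sin ((k%:R + 2^-1) * x)).

Definition C21_on (O : set (R * R)) (u ux uxx ut : R -> R -> R) : Prop :=
  (forall x t, O (x, t) ->
     is_derive x 1 (fun y => u y t) (ux x t) /\
     is_derive x 1 (fun y => ux y t) (uxx x t) /\
     is_derive t 1 (u x) (ut x t)) /\
  (forall p, O p ->
     {for p, continuous (fun q : R * R => u q.1 q.2)} /\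
     {for p, continuous (fun q : R * R => ux q.1 q.2)} /\
     {for p, continuous (fun q : R * R => uxx q.1 q.2)} /\
     {for p, continuous (fun q : R * R => ut q.1 q.2)}).

Definition regular_solution (T eps : R) (phi psi : R -> R)
    (u : R -> R -> R) (f : R -> R) : Prop :=
  exists ux uxx ut : R -> R -> R,
    C21_on (Omega T) u ux uxx ut /\
    {within Omega_bar T, continuous (fun q : R * R => u q.1 q.2)} /\
    {within `[-pi, pi], continuous f} /\
    (forall x t, Omega T (x, t) ->
       ut x t - uxx x t + eps * uxx (- x) t = f x) /\
    (forall x, -pi <= x <= pi -> u x 0 = phi x /\ u x T = psi x) /\
    (forall t, 0 <= t <= T -> u (- pi) t = 0 /\ u pi t = 0).

(* terms of the series in the solution formula;  p1,p2 := coefficients of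
   phi''', q1,q2 := coefficients of psi''' *)
Definition lam1 (eps : R) (k : nat) : R := (1 + eps) * (k%:R) ^+ 2.
Definition lam2 (eps : R) (k : nat) : R := (1 - eps) * (k%:R + 2^-1) ^+ 2.

Definition u_term1 (T eps : R) (p1 q1 : nat -> R) (x t : R) (k : nat) : R :=
  (1 - expR (- lam1 eps k * t)) / (1 - expR (- lam1 eps k * T)) *
  ((p1 k - q1 k) / (k%:R) ^+ 3) * sin (k%:R * x).
Definition u_term2 (T eps : R) (p2 q2 : nat -> R) (x t : R) (k : nat) : R :=
  (1 - expR (- lam2 eps k * t)) / (1 - expR (- lam2 eps k * T)) *
  ((p2 k - q2 k) / (k%:R + 2^-1) ^+ 3) * cos ((k%:R + 2^-1) * x).
Definition f_term1 (T eps : R) (p1 q1 : nat -> R) (x : R) (k : nat) : R :=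
  (1 + eps) / k%:R * ((p1 k - q1 k) / (1 - expR (- lam1 eps k * T))) *
  sin (k%:R * x).
Definition f_term2 (T eps : R) (p2 q2 : nat -> R) (x : R) (k : nat) : R :=
  (1 - eps) / (k%:R + 2^-1) * ((p2 k - q2 k) / (1 - expR (- lam2 eps k * T))) *
  cos ((k%:R + 2^-1) * x).

Definition psum1 (a : nat -> R) (n : nat) : R := \sum_(1 <= k < n) a k.
Definition psum0 (a : nat -> R) (n : nat) : R := \sum_(0 <= k < n) a k.

End Defs.

(* Main.v *)
(* Uniqueness.  The odd and even parts in x of the difference of two solutions
   solve V_t = a V_xx + F(x) with a = 1 + eps and a = 1 - eps, zero lateral
   values and zero values at t = 0 and t = T.  For 0 < h < T, the increments
   V(x, t + h) - V(x, t) and V(x, t + T - h) - V(x, t) solve the homogeneous heat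
   equation, so its solution operator takes V(h) to -V(T - h) in time T - h and
   V(T - h) to -V(h) in time h.  By the maximum principle it strictly contracts
   the norm sup |v(x)| / cos(x/4), hence V(h) = 0.

   Existence.  Bessel's inequality for phi''' and psi''' makes the series converge
   absolutely after differentiating once in t or twice in x, so they may be
   differentiated termwise.  The final condition u(x, T) = psi(x) is the pointwise
   convergence of the Fourier series of g = phi - psi in sin kx,
   cos (k + 1/2)x; after subtracting a multiple of cos(x/2) one may assume
   g(x0) = 0, and then g = q (sin(x/2) - sin(x0/2)) with q continuous makes the
   partial sums at x0 telescope to coefficients of q, which tend to 0 by
   Riemann-Lebesgue. *)

Require Import Defs.
From HB Require Import structures.
From mathcomp Require Import all_boot all_order all_algebra.
From mathcomp Require Import all_classical all_reals all_analysis.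
From mathcomp Require Import measurable_realfun ring lra.
Import Order.TTheory GRing.Theory Num.Theory.
Import numFieldNormedType.Exports.
Local Open Scope classical_set_scope.
Local Open Scope ring_scope.

Set Implicit Arguments.
Unset Strict Implicit.
Unset Printing Implicit Defensive.

(** * Series depending on a parameter *)

Section Series.
Context {R : realType}.
Implicit Types (a b M : nat -> R).

(** A regular solution is weak at the boundary: its derivatives are controlled only in the open
    rectangle, and [u] alone is continuous up to the edge. Projecting the equation on the modes
    would need control of u_xx near x = -pi and x = pi; the maximum principle needs none, but it has
    to be freed of the unknown source, which is what the time increments do. The weight cos(x/4) is
    taken because it is positive on the closed interval, whereas the first eigenfunction cos(x/2)
    vanishes at the end points, and because exp(-a t/16) cos(x/4) solves the heat equation and
    decays, which makes the contraction factor smaller than 1. On the existence side phi''' and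
    psi''' are only square integrable, so phi'' and psi'' are indefinite integrals that need not be
    differentiable at every point. Relating the coefficients of phi''' to those of phi therefore
    takes one integration by parts for an absolutely continuous factor besides two classical ones.
    Both mode families are written sin(w x + th), with th = 0 or th = pi / 2, so that each estimate
    is made once. *)

Lemma cvg_series_dominated a M : cvgn (series M) ->
  (forall k, `|a k| <= M k) -> cvgn (series a).
Proof.
move=> cM aM; apply: normed_cvg.
apply: (series_le_cvg _ _ aM cM) => [k|k] /=; first exact: normr_ge0.
exact: le_trans (normr_ge0 _) (aM k).
Qed.

(** The bound is a tail of the majorant alone, hence uniform over all series that [M] dominates. *)
Lemma series_tail_le a M N : cvgn (series M) -> (forall k, `|a k| <= M k) ->
  `|limn (series a) - series a N| <= limn (series M) - series M N.
Proof.
move=> cM aM; have ca := cvg_series_dominated cM aM.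
have h1 : `|series a n - series a N| @[n --> \oo] -->
    `|limn (series a) - series a N|.
  by apply: cvg_norm; apply: cvgB; [exact: ca|exact: cvg_cst].
have h2 : series M n - series M N @[n --> \oo] -->
    limn (series M) - series M N.
  by apply: cvgB; [exact: cM|exact: cvg_cst].
apply: (ler_cvg_to h1 h2); near=> n.
have Nn : (N <= n)%N by near: n; exact: nbhs_infty_ge.
rewrite !sub_series_geq//; apply: le_trans (ler_norm_sum _ _ _) _.
exact: ler_sum.
Unshelve. all: by end_near. Qed.

Lemma cvg_series_fin (I : Type) (F : set_system I) {FF : Filter F}
    (a : I -> nat -> R) b N : (forall k, a i k @[i --> F] --> b k) ->
  series (a i) N @[i --> F] --> series b N.
Proof.
move=> ab; elim: N => [|N IH].
  under eq_fun do rewrite /series /= big_geq//.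
  by rewrite /series /= big_geq//; exact: cvg_cst.
under eq_fun do rewrite seriesSr.
by rewrite seriesSr; apply: cvgD.
Qed.

(* Tannery's theorem *)
Lemma cvg_lim_series (I : Type) (F : set_system I) {FF : Filter F}
    (a : I -> nat -> R) b M : cvgn (series M) ->
  (\forall i \near F, forall k, `|a i k| <= M k) ->
  (forall k, `|b k| <= M k) ->
  (forall k, a i k @[i --> F] --> b k) ->
  limn (series (a i)) @[i --> F] --> limn (series b).
Proof.
move=> cM aM bM ab; apply/cvgrPdist_lt => e e0.
have e3 : 0 < e / 3 by rewrite divr_gt0.
have [N _ /(_ N (leqnn N))/=] : \forall n \near \oo,
    `|limn (series M) - series M n| < e / 3.
  by move/cvgrPdist_lt : cM; apply.
move=> /(le_lt_trans (ler_norm _)) tailN.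
have /cvgrPdist_lt/(_ _ e3) sN : series (a i) N @[i --> F] --> series b N.
  exact: cvg_series_fin.
apply: filterS2 aM sN => i aiM siN.
have h1 := le_lt_trans (series_tail_le N cM bM) tailN.
have h2 := le_lt_trans (series_tail_le N cM aiM) tailN.
move: h1 h2 siN; rewrite !ltr_norml => /andP[? ?] /andP[? ?] /andP[? ?].
by apply/andP; split; lra.
Qed.

Lemma is_derive_difference_quotient (f : R -> R) (x l : R) :
  h^-1 * (f (h + x) - f x) @[h --> 0^'] --> l -> is_derive x 1 f l.
Proof.
move=> Hf.
have Hf' : h^-1 *: ((f \o shift x) h%:A - f x) @[h --> 0^'] --> l.
  by under eq_fun do rewrite /= [_%:A]mulr1.
by constructor; [apply/cvg_ex; exists l|exact: cvg_lim Hf'].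
Qed.

Lemma cvg_difference_quotient (f : R -> R) (x l : R) : is_derive x 1 f l ->
  h^-1 * (f (h + x) - f x) @[h --> 0^'] --> l.
Proof.
move=> [df <-].
have : h^-1 *: ((f \o shift x) h%:A - f x) @[h --> 0^'] --> 'D_1 f x by exact: df.
by under eq_fun do rewrite /= [_%:A]mulr1.
Qed.

Lemma mvt_le (f f' : R -> R) (x e C : R) :
  (forall y, `|y - x| < e -> is_derive y 1 f (f' y)) ->
  (forall y, `|y - x| < e -> `|f' y| <= C) ->
  forall h, `|h| < e -> `|f (h + x) - f x| <= C * `|h|.
Proof.
move=> df f'C h he.
have main (p q : R) : p < q -> `|p - x| < e -> `|q - x| < e ->
    `|f q - f p| <= C * (q - p).
  move=> pq pe qe.
  have inxe z : p <= z <= q -> `|z - x| < e.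
    move: pe qe; rewrite !ltr_norml => /andP[? ?] /andP[? ?] /andP[? ?].
    by apply/andP; split; lra.
  have [| |c cpq ->] := @MVT R f f' p q pq.
  - by move=> y; rewrite in_itv/= => /andP[? ?]; apply/df/inxe; rewrite !ltW.
  - apply: derivable_within_continuous => y; rewrite in_itv/= => ypq.
    by have [] := df _ (inxe _ ypq).
  rewrite normrM (@ger0_norm _ (q - p)) ?subr_ge0 ?(ltW pq)//.
  apply: ler_wpM2r; first by rewrite subr_ge0 ltW.
  by apply/f'C/inxe; move: cpq; rewrite in_itv/= => /andP[? ?]; rewrite !ltW.
have e0 : `|x - x| < e by rewrite subrr normr0; apply: le_lt_trans he.
have he' : `|h + x - x| < e by rewrite addrK.
have [h0|h0|->] := ltgtP h 0.
- have hx : h + x < x by lra.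
  have := main _ _ hx he' e0; rewrite (distrC (f x)) (ltr0_norm h0).
  by have -> : x - (h + x) = - h by ring.
- have hx : x < h + x by lra.
  by have := main _ _ hx e0 he'; rewrite (gtr0_norm h0) addrK.
- by rewrite add0r subrr normr0 mulr0.
Qed.

(** Termwise differentiation is Tannery's theorem for the difference quotients as h tends to 0: by
    the mean value theorem, the majorant of the derivatives also bounds the quotients. *)
Lemma is_derive_series (f f' : nat -> R -> R) (x e : R) M :
  0 < e -> cvgn (series M) ->
  (forall y, `|y - x| < e -> cvgn (series (f ^~ y))) ->
  (forall k y, `|y - x| < e -> is_derive y 1 (f k) (f' k y)) ->
  (forall k y, `|y - x| < e -> `|f' k y| <= M k) ->
  is_derive x 1 (fun y => limn (series (f ^~ y))) (limn (series (f' ^~ x))).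
Proof.
move=> e0 cM cf df f'M; apply: is_derive_difference_quotient.
have xx : `|x - x| < e by rewrite subrr normr0.
have near_e : \forall h \near (0 : R)^', `|h| < e /\ h != 0.
  near=> h; split; last by near: h; exact: nbhs_dnbhs_neq.
  near: h; apply: dnbhs0_lt => //.
pose q h k := h^-1 * (f k (h + x) - f k x).
suff : limn (series (q h)) @[h --> 0^'] --> limn (series (f' ^~ x)).
  apply: cvg_trans; apply: near_eq_cvg; apply: filterS near_e => h [he h0].
  have hx : `|h + x - x| < e by rewrite addrK.
  apply/(@cvg_lim R) => //.
  have -> : series (q h) =
      fun n => h^-1 * (series (f ^~ (h + x)) n - series (f ^~ x) n).
    apply/funext => n; rewrite /series /= -mulr_sumr; congr (_ * _).
    by rewrite -sumrB.
  by apply: cvgM; [exact: cvg_cst|apply: cvgB; exact: cf].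
apply: (@cvg_lim_series _ _ _ _ _ M) => //.
- apply: filterS near_e => h [he h0] k; rewrite /q normrM normfV.
  rewrite mulrC ler_pdivrMr ?normr_gt0//.
  by apply: (@mvt_le (f k) (f' k) x e) => // y ye; exact: f'M.
- by move=> k; exact: f'M.
- by move=> k; apply: cvg_difference_quotient; exact: df.
Unshelve. all: by end_near. Qed.

End Series.

(** * Mode series *)

Section ElementaryDerivatives.
Context {R : realType}.
Implicit Types (f : R -> R).

Lemma is_derive_scale f (c x l : R) : is_derive x 1 f l ->
  is_derive x 1 (fun y => c * f y) (c * l).
Proof. by move=> fl; exact: is_deriveZ. Qed.

Lemma is_derive_affine f (w t x l : R) : is_derive (w * x + t) 1 f l ->
  is_derive x 1 (fun y => f (w * y + t)) (w * l).
Proof.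
move=> fl; rewrite mulrC; apply: (@is_derive1_comp _ f (fun y => w * y + t)).
rewrite -[w in is_derive _ _ _ w]addr0; apply: is_deriveD.
by rewrite -[w in is_derive _ _ _ w]mulr1; apply: is_derive_scale.
Qed.

Lemma is_derive_sin_affine (w t x : R) :
  is_derive x 1 (fun y => sin (w * y + t)) (w * cos (w * x + t)).
Proof. exact: is_derive_affine. Qed.

Lemma is_derive_cos_affine (w t x : R) :
  is_derive x 1 (fun y => cos (w * y + t)) (w * - sin (w * x + t)).
Proof. exact: is_derive_affine. Qed.

Lemma is_derive_expR_lin (w x : R) :
  is_derive x 1 (fun y => expR (w * y)) (w * expR (w * x)).
Proof.
have := @is_derive_affine expR w 0 x _ (is_derive_expR _).
by under eq_fun do rewrite addr0; rewrite addr0.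
Qed.

Lemma continuous_affine (w t : R) : continuous (fun y : R => w * y + t).
Proof.
move=> x; apply: cvgD; last exact: cvg_cst.
by apply: cvgM; [exact: cvg_cst|exact: cvg_id].
Qed.

Lemma sin_affine_continuous (w t : R) : continuous (fun x => sin (w * x + t)).
Proof.
move=> x; apply: (@continuous_comp _ _ _ (fun x => w * x + t) sin).
  exact: continuous_affine.
exact: continuous_sin.
Qed.

Lemma cos_affine_continuous (w t : R) : continuous (fun x => cos (w * x + t)).
Proof.
move=> x; apply: (@continuous_comp _ _ _ (fun x => w * x + t) cos).
  exact: continuous_affine.
exact: continuous_cos.
Qed.

Lemma expR_lin_continuous (w : R) : continuous (fun x => expR (w * x)).
Proof.
move=> t; apply: (@continuous_comp R R R (fun x => w * x) (@expR R)).
  by apply: cvgM; [exact: cvg_cst|exact: cvg_id].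
exact: continuous_expR.
Qed.

End ElementaryDerivatives.

Lemma open_Omega {R : realType} (T : R) : open (Omega T).
Proof.
have -> : Omega T = (fst @^-1` `]- pi, pi[) `&` (snd @^-1` `]0, T[).
  by apply/seteqP; split=> -[x t] /=; rewrite /Omega/= !in_itv/=.
by apply: openI; apply: open_comp; (try exact: interval_open) => -[x t] _;
  [exact: cvg_fst|exact: cvg_snd].
Qed.

Section SeriesContinuity.
Context {R : realType} {S : topologicalType}.

Lemma within_continuous_series (O : set S) (g : nat -> S -> R) (M : nat -> R) :
  (forall k, continuous (g k)) -> cvgn (series M) ->
  (forall k q, O q -> `|g k q| <= M k) ->
  {within O, continuous (fun q => limn (series (g ^~ q)))}.
Proof.
move=> cg cM gM; apply/subspace_continuousP => p Op.
apply: (@cvg_lim_series _ _ _ _ (fun q => g ^~ q) (g ^~ p) M) => //.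
- by rewrite near_withinE; near=> q => Oq k; exact: gM.
- by move=> k; exact: gM.
- by move=> k; apply: cvg_within_filter; exact: cg.
Unshelve. all: by end_near. Qed.

End SeriesContinuity.

(* The series of the solution formula for one family of modes: amplitudes
   [d k], frequencies [om k], phase [th], diffusivity [a].  The sine family has
   a junk mode of frequency 0, which is harmless because its amplitude is
   [x / 0 = 0]. *)
Section ModeSeries.
Context {R : realType}.
Variables (a T th : R) (om d : nat -> R).
Hypotheses (a0 : 0 < a) (T0 : 0 < T).
Hypothesis om_half : forall k, 2^-1 <= om k \/ d k = 0.
Hypothesis cvg_omd : cvgn (series (fun k => om k ^+ 2 * `|d k|)).

Let lam k := a * om k ^+ 2.
Let den k : R := 1 - expR (- lam k * T).
Let E k (t : R) : R := (1 - expR (- lam k * t)) / den k.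

Definition mode_u (x t : R) k := E k t * d k * sin (om k * x + th).
Definition mode_ux (x t : R) k := E k t * d k * (om k * cos (om k * x + th)).
Definition mode_uxx (x t : R) k :=
  E k t * d k * (om k * (om k * - sin (om k * x + th))).
Definition mode_ut (x t : R) k :=
  (lam k * expR (- lam k * t) / den k) * d k * sin (om k * x + th).
Definition mode_f (x : R) k := lam k / den k * d k * sin (om k * x + th).

(** Since om >= 1/2 gives lam >= a/4, [K] bounds all inverse denominators of the modes that matter.
    The majorant [M] serves every series at once: the 4 comes from 1 <= 4 om^2 and om <= 4 om^2, the
    a K from the time derivative. *)
Let K := (1 - expR (- (a * 4^-1) * T))^-1.
Let M k := (4 + a * K) * (om k ^+ 2 * `|d k|).

Let om_sqr k : 2^-1 <= om k -> 1 <= 4 * om k ^+ 2 /\ om k <= 4 * om k ^+ 2.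
Proof.
move=> ok; have h1 : 0 <= 2 * om k - 1 by lra.
have h2 : 0 <= (2 * om k - 1) * (2 * om k + 1) by rewrite mulr_ge0//; lra.
have h3 : 0 <= (2 * om k - 1) * om k by rewrite mulr_ge0//; lra.
have e2 : (2 * om k - 1) * (2 * om k + 1) = 4 * om k ^+ 2 - 1 by ring.
have e3 : (2 * om k - 1) * om k = 2 * om k ^+ 2 - om k by ring.
by move: h2 h3; rewrite e2 e3; split; lra.
Qed.

Let den_gt0 k : 2^-1 <= om k -> 0 < den k.
Proof.
move=> ok; have ? : 0 < om k by lra.
by rewrite subr_gt0 -expR0 ltr_expR mulNr oppr_lt0 !mulr_gt0.
Qed.

Let q0_gt0 : 0 < 1 - expR (- (a * 4^-1) * T).
Proof. by rewrite subr_gt0 -expR0 ltr_expR mulNr oppr_lt0 !mulr_gt0. Qed.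

Let K0 : 0 < K. Proof. by rewrite invr_gt0. Qed.

Let denV_le k : 2^-1 <= om k -> (den k)^-1 <= K.
Proof.
move=> ok; have dk := den_gt0 ok.
rewrite /K lef_pV2 ?posrE // /den lerD2l lerN2 ler_expR !mulNr lerN2.
apply: ler_wpM2r; first exact: ltW.
by apply: ler_wpM2l; [exact: ltW|have [] := om_sqr ok; lra].
Qed.

Let omd_bound k : `|d k| <= 4 * (om k ^+ 2 * `|d k|) /\
  `|d k| * `|om k| <= 4 * (om k ^+ 2 * `|d k|).
Proof.
case: (om_half k) => [ok|->]; last by rewrite normr0 !(mulr0, mul0r).
have d0 := normr_ge0 (d k); rewrite (@ger0_norm _ (om k)); last by lra.
have [h1 h2] := om_sqr ok.
split; rewrite mulrA; first by rewrite -[leLHS]mul1r; exact: ler_wpM2r.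
by rewrite [leLHS]mulrC; exact: ler_wpM2r.
Qed.

Let cvgM4 : cvgn (series M).
Proof. exact: is_cvg_seriesZ. Qed.

(** The time factor [E k t] lies in [0, 1], because 1 - exp(-lam t) increases from 0 at t = 0 to
    [den k] at t = T. *)
Let E_bound k t : 0 <= t <= T -> `|E k t * d k| <= `|d k|.
Proof.
move=> /andP[t0 tT]; case: (om_half k) => [ok|->]; last first.
  by rewrite mulr0 normr0.
rewrite normrM ler_piMl//.
have lam0 : 0 <= lam k by rewrite mulr_ge0 ?sqr_ge0// ltW.
rewrite ger0_norm.
  rewrite ler_pdivrMr ?den_gt0// mul1r lerD2l lerN2 ler_expR.
  by rewrite !mulNr lerN2 ler_wpM2l.
rewrite divr_ge0 ?(ltW (den_gt0 ok))// subr_ge0 -expR0 ler_expR mulNr oppr_le0.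
exact: mulr_ge0.
Qed.

Let sqd0 k : 0 <= om k ^+ 2 * `|d k|.
Proof. by rewrite mulr_ge0 ?sqr_ge0. Qed.

Let leM k : 4 * (om k ^+ 2 * `|d k|) <= M k.
Proof.
by rewrite /M; apply: ler_wpM2r => //; rewrite lerDl mulr_ge0 // ltW.
Qed.

Lemma mode_u_le k x t : 0 <= t <= T -> `|mode_u x t k| <= M k.
Proof.
move=> tT; rewrite /mode_u normrM; apply: le_trans (leM k).
apply: le_trans (proj1 (omd_bound k)).
rewrite -[leRHS]mulr1; apply: ler_pM => //; first exact: E_bound.
exact: sin_max.
Qed.

Lemma mode_ux_le k x t : 0 <= t <= T -> `|mode_ux x t k| <= M k.
Proof.
move=> tT; rewrite /mode_ux normrM; apply: le_trans (leM k).
apply: le_trans (proj2 (omd_bound k)).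
apply: ler_pM => //; first exact: E_bound.
by rewrite normrM ler_piMr// cos_max.
Qed.

Lemma mode_uxx_le k x t : 0 <= t <= T -> `|mode_uxx x t k| <= M k.
Proof.
move=> tT; rewrite /mode_uxx normrM; apply: le_trans (leM k).
apply: (@le_trans _ _ (`|d k| * (om k ^+ 2))).
  apply: ler_pM => //; first exact: E_bound.
  rewrite mulrA -expr2 normrM normrN (@ger0_norm _ (om k ^+ 2)) ?sqr_ge0//.
  by rewrite ler_piMr ?sqr_ge0// sin_max.
by rewrite mulrC ler_peMl// ler1n.
Qed.

Lemma mode_ut_le k x t : 0 <= t -> `|mode_ut x t k| <= M k.
Proof.
move=> t0; rewrite /mode_ut normrM.
have lam0 : 0 <= lam k by rewrite mulr_ge0 ?sqr_ge0// ltW.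
apply: (@le_trans _ _ (a * K * (om k ^+ 2 * `|d k|))); last first.
  by apply: ler_wpM2r => //; rewrite lerDr.
rewrite -[leRHS]mulr1; apply: ler_pM => //; last exact: sin_max.
case: (om_half k) => [ok|->]; last by rewrite !(normr0, mulr0).
rewrite normrM [leRHS]mulrA; apply: ler_wpM2r => //.
have dk0 := ltW (den_gt0 ok).
have le0 : 0 <= lam k * expR (- lam k * t) by rewrite mulr_ge0 ?expR_ge0.
rewrite ger0_norm; last by rewrite divr_ge0.
rewrite [leRHS]mulrAC; apply: ler_pM.
- by [].
- by rewrite invr_ge0.
- rewrite ler_piMr// -expR0 ler_expR mulNr oppr_le0; exact: mulr_ge0.
- exact: denV_le.
Qed.

(** A source mode is the time derivative of the corresponding mode of [u] at t = 0. *)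
Lemma mode_f_le k x : `|mode_f x k| <= M k.
Proof.
have := @mode_ut_le k x 0 (lexx _).
by rewrite /mode_ut mulr0 expR0 mulr1.
Qed.

Lemma cvg_mode_u x t : 0 <= t <= T -> cvgn (series (mode_u x t)).
Proof.
by move=> tT; apply: cvg_series_dominated cvgM4 _ => k; exact: mode_u_le.
Qed.

Lemma cvg_mode_ux x t : 0 <= t <= T -> cvgn (series (mode_ux x t)).
Proof.
by move=> tT; apply: cvg_series_dominated cvgM4 _ => k; exact: mode_ux_le.
Qed.

Lemma cvg_mode_uxx x t : 0 <= t <= T -> cvgn (series (mode_uxx x t)).
Proof.
by move=> tT; apply: cvg_series_dominated cvgM4 _ => k; exact: mode_uxx_le.
Qed.

Lemma cvg_mode_ut x t : 0 <= t -> cvgn (series (mode_ut x t)).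
Proof.
by move=> tT; apply: cvg_series_dominated cvgM4 _ => k; exact: mode_ut_le.
Qed.

Lemma cvg_mode_f x : cvgn (series (mode_f x)).
Proof. by apply: cvg_series_dominated cvgM4 _ => k; exact: mode_f_le. Qed.

Let is_derive_E k (t : R) : is_derive t 1 (E k) (lam k * expR (- lam k * t) / den k).
Proof.
have -> : E k = (fun y => (den k)^-1 * (1 - expR (- lam k * y))).
  by apply/funext => y; rewrite mulrC.
rewrite mulrC; apply: is_derive_scale.
have -> : lam k * expR (- lam k * t) = 0 - (- lam k * expR (- lam k * t)).
  by rewrite sub0r -(mulNr (- lam k)) opprK.
by apply: is_deriveB; exact: is_derive_expR_lin.
Qed.

Lemma is_derive_mode_ux (x t : R) : 0 <= t <= T ->
  is_derive x 1 (fun y => limn (series (mode_u y t))) (limn (series (mode_ux x t))).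
Proof.
move=> tT.
apply: (@is_derive_series _ (fun k y => mode_u y t k) (fun k y => mode_ux y t k)
  x 1 M ltr01 cvgM4).
- by move=> y _; exact: cvg_mode_u.
- by move=> k y _; apply: is_derive_scale; exact: is_derive_sin_affine.
- by move=> k y _; exact: mode_ux_le.
Qed.

Lemma is_derive_mode_uxx (x t : R) : 0 <= t <= T ->
  is_derive x 1 (fun y => limn (series (mode_ux y t)))
    (limn (series (mode_uxx x t))).
Proof.
move=> tT.
apply: (@is_derive_series _ (fun k y => mode_ux y t k)
  (fun k y => mode_uxx y t k) x 1 M ltr01 cvgM4).
- by move=> y _; exact: cvg_mode_ux.
- move=> k y _; do 2 apply: is_derive_scale.
  exact: is_derive_cos_affine.
- by move=> k y _; exact: mode_uxx_le.
Qed.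

Lemma is_derive_mode_ut (x t : R) : 0 < t < T ->
  is_derive t 1 (fun s => limn (series (mode_u x s)))
    (limn (series (mode_ut x t))).
Proof.
move=> /andP[t0 tT].
(* The modes are dominated only for times in [0, T], so the ball around t must stay inside. *)
pose r := Num.min t (T - t).
have r0 : 0 < r by rewrite lt_min t0 subr_gt0.
have inT y : `|y - t| < r -> 0 <= y <= T.
  rewrite lt_min !ltr_norml => /andP[/andP[? ?] /andP[? ?]].
  by apply/andP; split; lra.
apply: (@is_derive_series _ (fun k s => mode_u x s k)
  (fun k s => mode_ut x s k) t r M r0 cvgM4).
- by move=> y /inT; exact: cvg_mode_u.
- move=> k y _.
  have -> : (fun s => mode_u x s k) =
      fun s => (d k * sin (om k * x + th)) * E k s.
    by apply/funext => s; rewrite /mode_u -(mulrA _ (d k)) mulrC.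
  rewrite /mode_ut -(mulrA _ (d k)) [X in is_derive _ _ _ X]mulrC.
  by apply: is_derive_scale; exact: is_derive_E.
- by move=> k y /inT/andP[? _]; exact: mode_ut_le.
Qed.

Let mode_cont (g h : R -> R) (c : R) : continuous g -> continuous h ->
  continuous (fun q : R * R => g q.2 * c * h q.1).
Proof.
move=> cg ch [x t]; apply: cvgM.
  apply: cvgM; last exact: cvg_cst.
  by apply: (@continuous_comp _ _ _ snd g); [exact: cvg_snd|exact: cg].
by apply: (@continuous_comp _ _ _ fst h); [exact: cvg_fst|exact: ch].
Qed.

Let cont_E k : continuous (E k).
Proof.
by move=> t; apply: differentiable_continuous; apply/derivable1_diffP;
  have [] := is_derive_E k t.
Qed.

Let cont_sin k : continuous (fun x => sin (om k * x + th)).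
Proof. exact: sin_affine_continuous. Qed.

Let cont_cos k : continuous (fun x => cos (om k * x + th)).
Proof. exact: cos_affine_continuous. Qed.

Let scale_cont (g : R -> R) c : continuous g -> continuous (fun x => c * g x).
Proof. by move=> cg x; apply: cvgM; [exact: cvg_cst|exact: cg]. Qed.

Let strip : set (R * R) := [set q | 0 <= q.2 <= T].

Lemma continuous_mode_u :
  {within strip, continuous (fun q : R * R => limn (series (mode_u q.1 q.2)))}.
Proof.
apply: (@within_continuous_series R (R * R)%type strip
  (fun k q => mode_u q.1 q.2 k) M _ cvgM4).
- by move=> k; exact: (mode_cont (c := d k) (@cont_E k) (@cont_sin k)).
- by move=> k q; exact: mode_u_le.
Qed.

Lemma continuous_mode_ux :
  {within strip, continuous (fun q : R * R => limn (series (mode_ux q.1 q.2)))}.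
Proof.
apply: (@within_continuous_series R (R * R)%type strip
  (fun k q => mode_ux q.1 q.2 k) M _ cvgM4).
- by move=> k; exact: (mode_cont (c := d k) (@cont_E k) (scale_cont (@cont_cos k))).
- by move=> k q; exact: mode_ux_le.
Qed.

Lemma continuous_mode_uxx :
  {within strip, continuous (fun q : R * R => limn (series (mode_uxx q.1 q.2)))}.
Proof.
apply: (@within_continuous_series R (R * R)%type strip
  (fun k q => mode_uxx q.1 q.2 k) M _ cvgM4).
- move=> k; have cN : continuous (fun x => - sin (om k * x + th)).
    by move=> x; apply: cvgN; exact: cont_sin.
  exact: (mode_cont (c := d k) (@cont_E k)
    (scale_cont (c := om k) (scale_cont (c := om k) cN))).
- by move=> k q; exact: mode_uxx_le.
Qed.

Lemma continuous_mode_ut :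
  {within strip, continuous (fun q : R * R => limn (series (mode_ut q.1 q.2)))}.
Proof.
apply: (@within_continuous_series R (R * R)%type strip
  (fun k q => mode_ut q.1 q.2 k) M _ cvgM4).
- move=> k.
  apply: (@mode_cont (fun t => lam k * expR (- lam k * t) / den k)
    (fun x => sin (om k * x + th)) (d k) _ (@cont_sin k)).
  move=> t; apply: cvgM; last exact: cvg_cst.
  by apply: cvgM; [exact: cvg_cst|exact: expR_lin_continuous].
- by move=> k q /andP[? _]; exact: mode_ut_le.
Qed.

Lemma continuous_mode_f : continuous (fun x : R => limn (series (mode_f x))).
Proof.
apply/continuous_subspace_setT.
apply: (@within_continuous_series R R setT (fun k x => mode_f x k) M _ cvgM4).
- by move=> k; exact: scale_cont.
- by move=> k q _; exact: mode_f_le.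
Qed.

(** In each mode the exponential cancels: lam exp(-lam t) / den + lam (1 - exp(-lam t)) / den = lam
    / den. Hence the source does not depend on t. *)
Lemma mode_equation x t : 0 <= t <= T ->
  limn (series (mode_ut x t)) - a * limn (series (mode_uxx x t)) =
  limn (series (mode_f x)).
Proof.
move=> tT; have t0 : 0 <= t by case/andP: tT.
apply/esym/cvg_lim => //.
have -> : series (mode_f x) =
    fun n => series (mode_ut x t) n - a * series (mode_uxx x t) n.
  apply/funext => n; rewrite /series /= mulr_sumr -sumrB.
  by apply: eq_bigr => k _; rewrite /mode_f /mode_ut /mode_uxx /E /lam; ring.
apply: cvgB; first exact: cvg_mode_ut.
by apply: cvgM; [exact: cvg_cst|exact: cvg_mode_uxx].
Qed.

Lemma mode_u0 x : limn (series (mode_u x 0)) = 0.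
Proof.
have -> : series (mode_u x 0) = fun=> 0.
  apply/funext => n; rewrite /series /= big1// => k _.
  by rewrite /mode_u /E mulr0 expR0 subrr !mul0r.
exact: lim_cst.
Qed.

Lemma mode_uT x : mode_u x T = fun k => d k * sin (om k * x + th).
Proof.
apply/funext => k; rewrite /mode_u /E.
(* The case [d k = 0] absorbs the mode of frequency 0, whose factor [E k T] is 0 / 0 = 0 instead of
   1. *)
case: (om_half k) => [ok|->]; last by rewrite mulr0.
by rewrite divff ?mul1r// gt_eqF// den_gt0.
Qed.

End ModeSeries.

(** * The maximum principle *)

Lemma is_derive_shift_arg {R : realType} (f : R -> R) (h t l : R) :
  is_derive (t + h) 1 f l -> is_derive t 1 (fun s => f (s + h)) l.
Proof.
have -> : (fun s => f (s + h)) = fun s => f (1 * s + h).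
  by apply/funext => s; rewrite mul1r.
by move=> fl; rewrite -[l]mul1r; apply: is_derive_affine; rewrite mul1r.
Qed.

Lemma is_derive_opp_arg {R : realType} (f : R -> R) (x l : R) :
  is_derive (- x) 1 f l -> is_derive x 1 (fun y => f (- y)) (- l).
Proof.
have -> : (fun y => f (- y)) = fun y => f (-1 * y + 0).
  by apply/funext => y; rewrite mulN1r addr0.
move=> fl; rewrite -[- l]mulN1r.
by apply: is_derive_affine; rewrite mulN1r addr0.
Qed.

Lemma continuous_pair {T U V : topologicalType} (f : T -> U) (g : T -> V) :
  continuous f -> continuous g -> continuous (fun x => (f x, g x)).
Proof.
move=> cf cg x; apply: (@cvg_pair _ _ _ _ (nbhs (f x)) (nbhs (g x)) _ _ _ f g).
  exact: cf.
exact: cg.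
Qed.

Lemma within_continuous_comp_map {X Y Z : topologicalType} (A : set X)
    (B : set Y) (f : Y -> Z) (g : X -> Y) :
  continuous g -> (forall x, A x -> B (g x)) -> {within B, continuous f} ->
  {within A, continuous (fun x => f (g x))}.
Proof.
move=> cg AB /subspace_continuousP cf; apply/subspace_continuousP => x Ax.
have cfx := cf _ (AB _ Ax).
apply: (cvg_comp _ _ _ cfx).
move=> P; rewrite /within/= => BP.
have h : \forall y \near x, B (g y) -> P (g y) by exact: (cg x _ BP).
change (\forall y \near within A (nbhs x), P (g y)); rewrite near_withinE.
by apply: filterS h => y h Ay; exact/h/AB.
Qed.

Section MaximumPrinciple.
Context {R : realType}.

Lemma dnbhs0_ball (P : set R) : (\forall h \near (0 : R)^', P h) ->
  exists2 e, 0 < e & forall h, h != 0 -> `|h| < e -> P h.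
Proof.
move=> [e /= e0 eP]; exists e => // h h0 he; apply: eP => //=.
by rewrite sub0r normrN.
Qed.

Lemma is_derive_locally0 (f : R -> R) (x e l : R) : 0 < e ->
  (forall y, `|y - x| < e -> f y = 0) -> is_derive x 1 f l -> l = 0.
Proof.
move=> e0 f0 /cvg_difference_quotient fl.
have fl0 : h^-1 * (f (h + x) - f x) @[h --> 0^'] --> (0 : R).
  suff : (fun=> 0 : R) h @[h --> (0 : R)^'] --> (0 : R).
    apply: cvg_trans; apply: near_eq_cvg.
    near=> h; rewrite !f0 ?subrr ?mulr0 ?normr0// addrK.
    by near: h; exact: dnbhs0_lt.
  exact: cvg_cst.
by apply: (@cvg_unique _ (@norm_hausdorff _ _) _ _ _ _ fl fl0).
Unshelve. all: by end_near. Qed.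

(** Only earlier times are compared, so that the lemma applies to a maximum on the top edge of the
    rectangle. *)
Lemma left_max_derive_ge0 (f : R -> R) (t e l : R) : 0 < e ->
  (forall s, t - e < s < t -> f s <= f t) -> is_derive t 1 f l -> 0 <= l.
Proof.
move=> e0 fmax /cvg_difference_quotient fl; rewrite leNgt; apply/negP => l0.
have [r r0 rP] := dnbhs0_ball (cvgr_lt _ fl _ l0).
pose h := - (Num.min r e / 2).
have m0 : 0 < Num.min r e by rewrite lt_min r0.
have [mr me] : Num.min r e <= r /\ Num.min r e <= e.
  by rewrite !ge_min !lexx orbT.
have h0 : h < 0 by rewrite /h; lra.
have := rP h (ltr0_neq0 h0); rewrite (ltr0_norm h0).
have hr : - h < r by rewrite /h; lra.
move=> /(_ hr); apply/negP; rewrite -leNgt; apply: mulr_le0.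
  by rewrite invr_le0 ltW.
by rewrite subr_le0; apply: fmax; rewrite /h; apply/andP; split; lra.
Qed.

(** At the maximum [f1] vanishes; if l > 0, then [f1] is positive just to the right of c, and the
    mean value theorem gives a larger value of [f] there. *)
Lemma max_derive2_le0 (f f1 : R -> R) (c e l : R) : 0 < e ->
  (forall y, `|y - c| < e -> is_derive y 1 f (f1 y)) ->
  (forall y, `|y - c| < e -> f y <= f c) ->
  is_derive c 1 f1 l -> l <= 0.
Proof.
move=> e0 df fmax /cvg_difference_quotient fl; rewrite leNgt; apply/negP => l0.
have inE' y : y \in `]c - e, c + e[ -> `|y - c| < e.
  by rewrite in_itv/= ltr_norml => /andP[? ?]; apply/andP; split; lra.
have cc : `|c - c| < e by rewrite subrr normr0.
have f1c : f1 c = 0.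
  have cmax : is_derive c 1 f 0.
    apply: (@derive1_at_max _ f (c - e) (c + e)); first lra.
    - by move=> t /inE'/df[].
    - by rewrite in_itv/=; apply/andP; split; lra.
    - by move=> t /inE'; exact: fmax.
  by have [_ <-] := df c cc; have [_ ->] := cmax.
have [r r0 rP] := dnbhs0_ball (cvgr_gt _ fl _ l0).
pose h := Num.min r e / 2.
have m0 : 0 < Num.min r e by rewrite lt_min r0.
have [mr me] : Num.min r e <= r /\ Num.min r e <= e.
  by rewrite !ge_min !lexx orbT.
have h0 : 0 < h by rewrite /h; lra.
have hr : h < r by rewrite /h; lra.
have he : h < e by rewrite /h; lra.
have near_c y : c <= y <= c + h -> `|y - c| < e.
  by move=> /andP[? ?]; rewrite ltr_norml; apply/andP; split; lra.
have [| | |z zc] := @MVT R f f1 c (c + h); first by lra.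
- by move=> y; rewrite in_itv/= => /andP[? ?]; apply/df/near_c; rewrite !ltW.
- apply: derivable_within_continuous => y; rewrite in_itv/= => yc.
  by have [] := df _ (near_c _ yc).
rewrite addrAC subrr add0r => fE.
have z0 : 0 < z - c by move: zc; rewrite in_itv/= => /andP[? ?]; lra.
have zr : `|z - c| < r.
  by rewrite (gtr0_norm z0); move: zc; rewrite in_itv/= => /andP[? ?]; lra.
have := rP _ (lt0r_neq0 z0) zr; rewrite subrK f1c subr0 pmulr_rgt0 ?invr_gt0// => f1z.
have : 0 < f1 z * h by rewrite mulr_gt0.
rewrite -fE subr_gt0; apply/negP; rewrite -leNgt; apply: fmax.
by apply: near_c; apply/andP; split; lra.
Qed.

Lemma compact_Omega_bar (S : R) : compact (Omega_bar S).
Proof.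
have -> : Omega_bar S = `[- pi, pi] `*` `[0, S].
  by apply/seteqP; split=> -[x t]; rewrite /Omega_bar /= !in_itv.
by apply: compact_setX; exact: segment_compact.
Qed.

(** A maximum point off the bottom and the lateral sides would have Zt >= 0 and Zxx <= 0, against
    the strict inequality. The inequality is demanded at t = S as well, since the maximum over the
    closed rectangle may be attained there. *)
Lemma heat_max (a S : R) (Z Zx Zxx Zt : R -> R -> R) : 0 <= a ->
  {within Omega_bar S, continuous (fun q : R * R => Z q.1 q.2)} ->
  (forall x t, - pi < x < pi -> 0 < t <= S ->
    [/\ is_derive x 1 (Z ^~ t) (Zx x t), is_derive x 1 (Zx ^~ t) (Zxx x t),
        is_derive t 1 (Z x) (Zt x t) & Zt x t - a * Zxx x t < 0]) ->
  (forall x, - pi <= x <= pi -> Z x 0 <= 0) ->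
  (forall t, 0 <= t <= S -> Z (- pi) t <= 0 /\ Z pi t <= 0) ->
  forall x t, Omega_bar S (x, t) -> Z x t <= 0.
Proof.
move=> a0 cZ dZ Z0 Zpi x0 t0 Ox0.
have ne : Omega_bar S !=set0 by exists (x0, t0).
have [[x t]] := compact_EVT_max ne (@compact_Omega_bar S) cZ.
rewrite inE => -[/= /andP[x1 x2] /andP[t1 t2]] mx.
have {}mx y s : - pi <= y <= pi -> 0 <= s <= S -> Z y s <= Z x t.
  by move=> hy hs; apply: (mx (y, s)); rewrite inE.
suff : Z x t <= 0 by apply: le_trans; case: Ox0; exact: mx.
have [->|xN] := eqVneq x (- pi); first by apply (Zpi t); rewrite t1.
have [->|xP] := eqVneq x pi; first by apply (Zpi t); rewrite t1.
have [->|tN] := eqVneq t 0; first by apply Z0; rewrite x1.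
have {}x1 : - pi < x by rewrite lt_neqAle eq_sym xN.
have {}x2 : x < pi by rewrite lt_neqAle xP.
have {}t1 : 0 < t by rewrite lt_neqAle eq_sym tN.
have xpi : - pi < x < pi by rewrite x1.
have tS : 0 < t <= S by rewrite t1.
have [_ dxx dt ltz] := dZ _ _ xpi tS.
have Zt0 : 0 <= Zt x t.
  apply: (left_max_derive_ge0 t1 _ dt) => s /andP[s1 s2].
  by apply: mx; apply/andP; split; lra.
pose e := Num.min (x + pi) (pi - x).
have e0 : 0 < e by rewrite lt_min; apply/andP; split; lra.
have inpi y : `|y - x| < e -> - pi < y < pi.
  rewrite lt_min => /andP[]; rewrite !ltr_norml => /andP[? ?] /andP[? ?].
  by apply/andP; split; lra.
have Zxx0 : Zxx x t <= 0.
  apply: (@max_derive2_le0 (Z ^~ t) (Zx ^~ t) x e _ e0 _ _ dxx) => y /inpi ypi.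
    by have [] := dZ _ _ ypi tS.
  by move: ypi => /andP[? ?]; apply: mx; apply/andP; split; lra.
have : 0 <= a * - Zxx x t by rewrite mulr_ge0// oppr_ge0.
by rewrite mulrN; lra.
Qed.

(** On [-pi, pi] the argument stays within [-pi/4, pi/4]. The summand 0 is the phase in the lemmas
    on affine cosines. *)
Lemma cos4_gt0 (x : R) : - pi <= x <= pi -> 0 < cos (4^-1 * x + 0).
Proof.
have p0 := pi_gt0 R.
by move=> /andP[? ?]; apply: cos_gt0_pihalf; apply/andP; split; lra.
Qed.

End MaximumPrinciple.

(** * Uniqueness *)

Section Uniqueness.
Context {R : realType}.
Implicit Types (a T S : R) (V W : R -> R -> R).

(** The source depends on x alone, and the derivatives need only exist in the open rectangle.
    Conditions at t = 0 and t = T are left out because they change from one use to the next. *)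
Definition heat_solution a T (F : R -> R) V : Prop :=
  [/\ exists Vx Vxx Vt : R -> R -> R, forall x t, Omega T (x, t) ->
        [/\ is_derive x 1 (V ^~ t) (Vx x t), is_derive x 1 (Vx ^~ t) (Vxx x t),
            is_derive t 1 (V x) (Vt x t) & Vt x t - a * Vxx x t = F x],
      {within Omega_bar T, continuous (fun q : R * R => V q.1 q.2)} &
      forall t, 0 <= t <= T -> V (- pi) t = 0 /\ V pi t = 0].

Lemma heat_solutionN a T F V : heat_solution a T F V ->
  heat_solution a T (fun x => - F x) (fun x t => - V x t).
Proof.
move=> [[Vx [Vxx [Vt dV]]] cV Vpi]; split.
- exists (fun x t => - Vx x t), (fun x t => - Vxx x t), (fun x t => - Vt x t).
  move=> x t /dV[d1 d2 d3 e]; split; try exact: is_deriveN.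
  by rewrite mulrN -opprD e.
- by move=> q; apply: cvgN; exact: cV.
- by move=> t /Vpi[-> ->]; rewrite oppr0.
Qed.

Let barrier a M (x t : R) := M * expR (- (a * 16^-1) * t) * cos (4^-1 * x + 0).

(* The barrier [M exp(-a t/16) cos(x/4)] solves the heat equation and is
   positive on the lateral boundary; subtracting [r (1 + t)] makes the
   inequality for the maximum principle strict. *)
Lemma heat_decay_lt a S M W : 0 < a -> 0 <= M ->
  heat_solution a S (fun=> 0) W ->
  (forall x, - pi <= x <= pi -> W x 0 <= barrier a M x 0) ->
  forall x t, - pi <= x <= pi -> 0 <= t < S -> W x t <= barrier a M x t.
Proof.
move=> a0 M0 [[Wx [Wxx [Wt dW]]] cW Wpi] W0 x t xpi /andP[t0 tS].
have cos_ge0 y : - pi <= y <= pi -> 0 <= cos (4^-1 * y + 0) :> R.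
  by move/cos4_gt0/ltW.
have barrier_ge0 y s : - pi <= y <= pi -> 0 <= barrier a M y s.
  by move/cos_ge0 => ?; rewrite /barrier !mulr_ge0 ?expR_ge0.
suff H d : 0 < d -> W x t - barrier a M x t <= 0 + d.
  rewrite -subr_le0; apply/ler_addgt0Pr => d d0; exact: H.
(* With this slope the penalty r (1 + s) equals d at the time s = t under study. *)
move=> d0; pose r := d / (1 + t).
have t1 : 0 < 1 + t by lra.
have r0 : 0 < r by rewrite divr_gt0.
have -> : d = r * (1 + t) by rewrite divfK// gt_eqF.
rewrite add0r -subr_le0.
pose Z y s := W y s - barrier a M y s - r * (1 * s + 1).
have -> : W x t - barrier a M x t - r * (1 + t) = Z x t.
  by rewrite /Z mul1r (addrC t).
pose Zx y s :=
  Wx y s - M * expR (- (a * 16^-1) * s) * (4^-1 * - sin (4^-1 * y + 0)).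
pose Zxx y s :=
  Wxx y s - M * expR (- (a * 16^-1) * s) * (4^-1 * - (4^-1 * cos (4^-1 * y + 0))).
pose Zt y s :=
  Wt y s - (M * cos (4^-1 * y + 0)) *
    (- (a * 16^-1) * expR (- (a * 16^-1) * s)) - r * (1 * 1).
(* The rectangle stops at t < S: the equation is known only at times before S, and [heat_max] asks
   for it on the top edge. *)
apply: (@heat_max _ a t Z Zx Zxx Zt (ltW a0)).
- have sub : Omega_bar t `<=` Omega_bar S.
    by move=> q [? /andP[? ?]]; split=> //; apply/andP; split; lra.
  have c1 : {within Omega_bar t, continuous (fun q : R * R => W q.1 q.2)}.
    exact: continuous_subspaceW cW.
  have c2 : continuous (fun q : R * R => barrier a M q.1 q.2).
    move=> q; apply: cvgM; last first.
      apply: (@continuous_comp _ _ _ fst (fun y : R => cos (4^-1 * y + 0))).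
        exact: cvg_fst.
      exact: cos_affine_continuous.
    apply: cvgM; first exact: cvg_cst.
    apply: (@continuous_comp _ _ _ snd (fun s => expR (- (a * 16^-1) * s))).
      exact: cvg_snd.
    exact: expR_lin_continuous.
  have c3 : continuous (fun q : R * R => r * (1 * q.2 + 1)).
    move=> q; apply: cvgM; first exact: cvg_cst.
    apply: (@continuous_comp _ _ _ snd (fun s : R => 1 * s + 1)).
      exact: cvg_snd.
    exact: continuous_affine.
  have {}c2 := continuous_subspaceT (A := Omega_bar t) c2.
  have {}c3 := continuous_subspaceT (A := Omega_bar t) c3.
  by move=> q; apply: cvgB; [apply: cvgB; [exact: c1|exact: c2]|exact: c3].
- move=> y s ypi /andP[s0 st].
  have [d1 d2 d3 e] : [/\ is_derive y 1 (W ^~ s) (Wx y s),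
      is_derive y 1 (Wx ^~ s) (Wxx y s), is_derive s 1 (W y) (Wt y s) &
      Wt y s - a * Wxx y s = 0].
    by apply: dW; split=> //=; rewrite s0; lra.
  split.
  + rewrite -[Zx y s]subr0; apply: is_deriveB.
    by apply: is_deriveB; apply: is_derive_scale; exact: is_derive_cos_affine.
  + apply: is_deriveB; apply: is_derive_scale; apply: is_derive_scale.
    by apply: is_deriveN; exact: is_derive_sin_affine.
  + apply: is_deriveB; last first.
      apply: is_derive_scale.
      by rewrite -[1 * 1]addr0; apply: is_deriveD; exact: is_derive_scale.
    apply: is_deriveB.
    have -> : barrier a M y =
        fun s => (M * cos (4^-1 * y + 0)) * expR (- (a * 16^-1) * s).
      by apply/funext => z; rewrite /barrier mulrAC.
    by apply: is_derive_scale; exact: is_derive_expR_lin.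
  + have -> : Zt y s - a * Zxx y s = Wt y s - a * Wxx y s - r.
      by rewrite /Zt /Zxx; field.
    by rewrite e; lra.
- move=> y ypi; rewrite /Z; have := W0 y ypi; lra.
- move=> s /andP[s0 st]; have sS : 0 <= s <= S by apply/andP; split; lra.
  have [e1 e2] := Wpi s sS; have p0 := pi_ge0 R.
  have pi1 : - pi <= - (pi : R) <= pi by rewrite lexx /=; lra.
  have pi2 : - pi <= (pi : R) <= pi by rewrite lexx andbT; lra.
  have rs : 0 <= r * (1 * s + 1) by rewrite mulr_ge0; lra.
  have b1 := barrier_ge0 _ s pi1; have b2 := barrier_ge0 _ s pi2.
  by rewrite /Z e1 e2; split; lra.
- by split=> //=; apply/andP.
Qed.

(** At t = S there is no equation, only continuity up to the edge; the bound for t < S passes to the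
    left limit. *)
Lemma heat_decay_le a S M W : 0 < a -> 0 < S -> 0 <= M ->
  heat_solution a S (fun=> 0) W ->
  (forall x, - pi <= x <= pi -> W x 0 <= barrier a M x 0) ->
  forall x, - pi <= x <= pi -> W x S <= barrier a M x S.
Proof.
move=> a0 S0 M0 hW W0 x xpi; rewrite -subr_ge0.
pose g t := barrier a M x t - W x t.
have cg : {within `[0, S], continuous g}.
  have c1 : {within `[0, S], continuous (W x)}.
    case: hW => _ cW _.
    apply: (@within_continuous_comp_map _ _ _ _ _ (fun q : R * R => W q.1 q.2)
      (fun t => (x, t)) _ _ cW).
      by apply: continuous_pair => t; [exact: cvg_cst|exact: cvg_id].
    by move=> t /=; rewrite in_itv.
  have c2 : continuous (barrier a M x).
    move=> t; apply: cvgM; last exact: cvg_cst.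
    by apply: cvgM; [exact: cvg_cst|exact: expR_lin_continuous].
  have {}c2 := continuous_subspaceT (A := `[0, S]) c2.
  by move=> t; apply: cvgB; [exact: c2|exact: c1].
have [_ _ gS] := (continuous_within_itvP g S0).1 cg.
apply: (cvgr_to_ge gS).
near=> t; rewrite subr_ge0; apply: (heat_decay_lt a0 M0 hW W0 xpi).
apply/andP; split; last by near: t; exact: nbhs_left_lt.
by near: t; exact: nbhs_left_ge.
Unshelve. all: by end_near. Qed.

Lemma heat_decay a S M W : 0 < a -> 0 < S -> 0 <= M ->
  heat_solution a S (fun=> 0) W ->
  (forall x, - pi <= x <= pi -> `|W x 0| <= M * cos (4^-1 * x + 0)) ->
  forall x, - pi <= x <= pi ->
  `|W x S| <= M * expR (- (a * 16^-1) * S) * cos (4^-1 * x + 0).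
Proof.
move=> a0 S0 M0 hW W0 x xpi.
have b0 y : barrier a M y 0 = M * cos (4^-1 * y + 0).
  by rewrite /barrier mulr0 expR0 mulr1.
rewrite ler_norml lerNl; apply/andP; split.
- apply: (@heat_decay_le a S M (fun x t => - W x t)) => //.
    by have := heat_solutionN hW; under eq_fun do rewrite oppr0.
  by move=> y /W0; rewrite b0 ler_norml lerNl => /andP[].
- apply: (@heat_decay_le a S M W) => // y /W0; rewrite b0 ler_norml.
  by move/andP=> [].
Qed.

(** The source cancels between the times t + h and t because it does not depend on time; this
    eliminates the unknown [F]. *)
Lemma heat_solution_increment a T F V h : 0 < h -> h < T ->
  heat_solution a T F V ->
  heat_solution a (T - h) (fun=> 0) (fun x t => V x (t + h) - V x t).
Proof.
move=> h0 hT [[Vx [Vxx [Vt dV]]] cV Vpi]; split.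
- exists (fun x t => Vx x (t + h) - Vx x t),
    (fun x t => Vxx x (t + h) - Vxx x t), (fun x t => Vt x (t + h) - Vt x t).
  move=> x t [/= xpi /andP[t0 tT]].
  have [|a1 a2 a3 a4] := dV x (t + h).
    by split=> //=; apply/andP; split; lra.
  have [|b1 b2 b3 b4] := dV x t; first by split=> //=; apply/andP; split; lra.
  split; try exact: is_deriveB.
    by apply: is_deriveB; exact: is_derive_shift_arg.
  move: a4 b4; lra.
- have c1 : {within Omega_bar (T - h),
      continuous (fun q : R * R => V q.1 (q.2 + h))}.
    apply: (@within_continuous_comp_map _ _ _ _ _ (fun q : R * R => V q.1 q.2)
      (fun q => (q.1, q.2 + h)) _ _ cV).
      apply: continuous_pair => q; first exact: cvg_fst.
      by apply: cvgD; [exact: cvg_snd|exact: cvg_cst].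
    by move=> q [? /andP[? ?]]; split=> //=; apply/andP; split; lra.
  have c2 : {within Omega_bar (T - h), continuous (fun q : R * R => V q.1 q.2)}.
    apply: continuous_subspaceW cV => q [? /andP[? ?]].
    by split=> //; apply/andP; split; lra.
  by move=> q; apply: cvgB; [exact: c1|exact: c2].
- move=> t /andP[t0 tT].
  have [|-> ->] := Vpi (t + h); first by apply/andP; split; lra.
  by have [|-> ->] := Vpi t; [apply/andP; split; lra|rewrite subrr].
Qed.

(** The quotient by cos(x/4) is continuous on the closed interval, so its supremum is attained.
    Attainment is what turns a pointwise bound, read at that one point, into a comparison of two
    norms. *)
Lemma weighted_max T V t : 0 <= t <= T ->
  {within Omega_bar T, continuous (fun q : R * R => V q.1 q.2)} ->
  exists M, [/\ 0 <= M,
    forall x, - pi <= x <= pi -> `|V x t| <= M * cos (4^-1 * x + 0) &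
    exists2 x, - pi <= x <= pi & `|V x t| = M * cos (4^-1 * x + 0)].
Proof.
move=> tT cV; pose g x := `|V x t| / cos (4^-1 * x + 0).
have cg : {within `[- pi, pi], continuous g}.
  have c1 : {within `[- pi, pi], continuous (V ^~ t)}.
    apply: (@within_continuous_comp_map _ _ _ _ _ (fun q : R * R => V q.1 q.2)
      (fun x => (x, t)) _ _ cV).
      by apply: continuous_pair => x; [exact: cvg_id|exact: cvg_cst].
    by move=> x /=; rewrite in_itv.
  rewrite continuous_subspace_in => x; rewrite inE/= in_itv/= => xpi.
  apply: cvgM; first by apply: cvg_norm; exact: c1.
  apply: cvgV; first by rewrite gt_eqF// cos4_gt0.
  by apply: (continuous_subspaceT (A := `[- pi, pi])); exact: cos_affine_continuous.
have p0 := pi_ge0 R.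
have [|c cpi gc] := EVT_max _ cg; first by lra.
rewrite in_itv/= in cpi.
have gE x : - pi <= x <= pi -> `|V x t| = g x * cos (4^-1 * x + 0).
  by move=> xpi; rewrite divfK// gt_eqF// cos4_gt0.
exists (g c); split.
- by rewrite divr_ge0// ltW// cos4_gt0.
- move=> x xpi; rewrite gE//; apply: ler_wpM2r; first exact/ltW/cos4_gt0.
  by apply: gc; rewrite in_itv.
- by exists c => //; exact: gE.
Qed.

(* Both maps V(h) |-> -V(T - h) and V(T - h) |-> -V(h) are time steps of the
   homogeneous heat equation, hence contractions in the norm
   sup |v| / cos(x/4). *)
Lemma heat_solution_unique a T F V : 0 < a -> 0 < T -> heat_solution a T F V ->
  (forall x, - pi <= x <= pi -> V x 0 = 0 /\ V x T = 0) ->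
  forall x t, - pi <= x <= pi -> 0 <= t <= T -> V x t = 0.
Proof.
move=> a0 T0 hV V0 x t xpi /andP[t0 tT].
have [->|tN] := eqVneq t 0; first exact: (V0 x xpi).1.
have [->|tNT] := eqVneq t T; first exact: (V0 x xpi).2.
have {}t0 : 0 < t by rewrite lt_neqAle eq_sym tN.
have {}tT : t < T by rewrite lt_neqAle tNT.
have Tt0 : 0 < T - t by lra.
(* The increment by s starts from V(s) - V(0) = V(s) and ends, after time T - s, at V(T) - V(T - s)
   = - V(T - s). *)
have step s M : 0 < s -> s < T -> 0 <= M ->
    (forall y, - pi <= y <= pi -> `|V y s| <= M * cos (4^-1 * y + 0)) ->
    forall y, - pi <= y <= pi -> `|V y (T - s)| <=
      M * expR (- (a * 16^-1) * (T - s)) * cos (4^-1 * y + 0).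
  move=> s0 sT M0 hM y ypi.
  have hs : 0 < T - s by lra.
  have := heat_decay a0 hs M0 (heat_solution_increment s0 sT hV).
  have -> : T - s + s = T by ring.
  rewrite -[`|V y (T - s)|]normrN -(sub0r (V y _)) => H.
  have {}H := H _ y ypi; rewrite (V0 y ypi).2 in H; apply: H => z zpi.
  by rewrite add0r (V0 z zpi).1 subr0; exact: hM.
have [_ cV _] := hV.
have [|M1 [M10 M1le [x1 x1pi x1E]]] := @weighted_max T V t _ cV.
  by rewrite !ltW.
have [|M2 [M20 M2le [x2 x2pi x2E]]] := @weighted_max T V (T - t) _ cV.
  by apply/andP; split; lra.
have lt1 s : 0 < s -> expR (- (a * 16^-1) * s) < 1.
  by move=> s0; rewrite -expR0 ltr_expR mulNr oppr_lt0 !mulr_gt0.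
have M21 : M2 <= M1 * expR (- (a * 16^-1) * (T - t)).
  have := step _ _ t0 tT M10 M1le x2 x2pi.
  by rewrite x2E ler_pM2r// cos4_gt0.
have M12 : M1 <= M2 * expR (- (a * 16^-1) * t).
  have Tt : T - t < T by lra.
  have := step _ _ Tt0 Tt M20 M2le x1 x1pi.
  have -> : T - (T - t) = t by ring.
  by rewrite x1E ler_pM2r// cos4_gt0.
have M1M2 : M1 <= M2.
  by apply: le_trans M12 _; rewrite ler_piMr// ltW// lt1.
(* The chain M1 <= M2 <= M1 q with q < 1 leaves only M1 = 0. *)
have M1E : M1 = 0.
  apply/eqP; rewrite eq_le M10 andbT leNgt; apply/negP => M1p.
  have : M1 * expR (- (a * 16^-1) * (T - t)) < M1 * 1 by rewrite ltr_pM2l// lt1.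
  by rewrite mulr1; lra.
have := M1le x xpi; rewrite M1E mul0r => Vx0.
by apply/normr0_eq0/eqP; rewrite eq_le normr_ge0 Vx0.
Qed.

End Uniqueness.

(** This carries an identity for the source from the open interval, where the equation holds, to the
    end points. *)
Lemma within_itv_eq0 {R : realType} (g : R -> R) (a b : R) : a < b ->
  {within `[a, b], continuous g} -> (forall x, a < x < b -> g x = 0) ->
  forall x, a <= x <= b -> g x = 0.
Proof.
move=> ab /(continuous_within_itvP g ab)[_ ga gb] g0 x /andP[ax xb].
have [xa|xNa] := eqVneq x a.
  suff : g x @[x --> a^'+] --> (0 : R).
    by rewrite xa => g0'; apply: (@cvg_unique _ (@norm_hausdorff _ _) _ _ _ _ ga g0').
  suff : (fun=> 0 : R) x @[x --> a^'+] --> (0 : R).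
    apply: cvg_trans; apply: near_eq_cvg; near=> y; apply/esym/g0/andP; split.
      by near: y; exact: nbhs_right_gt.
    by near: y; exact: nbhs_right_lt.
  exact: cvg_cst.
have [xb'|xNb] := eqVneq x b.
  suff : g x @[x --> b^'-] --> (0 : R).
    by rewrite xb' => g0'; apply: (@cvg_unique _ (@norm_hausdorff _ _) _ _ _ _ gb g0').
  suff : (fun=> 0 : R) x @[x --> b^'-] --> (0 : R).
    apply: cvg_trans; apply: near_eq_cvg; near=> y; apply/esym/g0/andP; split.
      by near: y; exact: nbhs_left_gt.
    by near: y; exact: nbhs_left_lt.
  exact: cvg_cst.
by apply: g0; rewrite !lt_neqAle eq_sym xNa xNb ax.
Unshelve. all: by end_near. Qed.

(** * Reflection in x and uniqueness for the nonlocal problem *)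

Section RegularUniqueness.
Context {R : realType}.
Variables (T eps : R).
Hypotheses (T0 : 0 < T) (eps1 : `|eps| < 1).

Let oppi (x : R) : - pi <= x <= pi -> - pi <= - x <= pi.
Proof. by move=> /andP[? ?]; apply/andP; split; lra. Qed.

Let oppi_lt (x : R) : - pi < x < pi -> - pi < - x < pi.
Proof. by move=> /andP[? ?]; apply/andP; split; lra. Qed.

Let within_reflect (U : R -> R -> R) :
  {within Omega_bar T, continuous (fun q : R * R => U q.1 q.2)} ->
  {within Omega_bar T, continuous (fun q : R * R => U (- q.1) q.2)}.
Proof.
move=> cU.
apply: (@within_continuous_comp_map _ _ _ _ _ (fun q : R * R => U q.1 q.2)
      (fun q => (- q.1, q.2)) _ _ cU).
  by apply: continuous_pair => q; [apply: cvgN; exact: cvg_fst|exact: cvg_snd].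
by move=> q [? ?]; split=> //; exact: oppi.
Qed.

(* The odd and even parts in x of a solution of the homogeneous-data problem
   solve heat equations with diffusivities 1 + eps and 1 - eps. *)
Lemma reflected_heat_unique (U Ux Uxx Ut : R -> R -> R) (F : R -> R) :
  (forall x t, Omega T (x, t) ->
    [/\ is_derive x 1 (U ^~ t) (Ux x t), is_derive x 1 (Ux ^~ t) (Uxx x t),
        is_derive t 1 (U x) (Ut x t) &
        Ut x t - Uxx x t + eps * Uxx (- x) t = F x]) ->
  {within Omega_bar T, continuous (fun q : R * R => U q.1 q.2)} ->
  (forall x, - pi <= x <= pi -> U x 0 = 0 /\ U x T = 0) ->
  (forall t, 0 <= t <= T -> U (- pi) t = 0 /\ U pi t = 0) ->
  forall x t, Omega_bar T (x, t) -> U x t = 0.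
Proof.
move=> dU cU U0 Upi x t [/= xpi tT].
have dUN y s : Omega T (y, s) ->
    [/\ is_derive y 1 (fun z => U (- z) s) (- Ux (- y) s),
        is_derive y 1 (fun z => - Ux (- z) s) (Uxx (- y) s),
        is_derive s 1 (U (- y)) (Ut (- y) s) &
        Ut (- y) s - Uxx (- y) s + eps * Uxx y s = F (- y)].
  move=> [/= ypi sT]; have [|d1 d2 d3 e] := dU (- y) s.
    by split=> //=; exact: oppi_lt.
  split=> //; last by rewrite -e opprK.
    exact: is_derive_opp_arg.
  rewrite -[Uxx (- y) s]opprK.
  by apply: is_deriveN; exact: is_derive_opp_arg.
have [e1 e2] : 0 < 1 + eps /\ 0 < 1 - eps.
  by move: eps1; rewrite ltr_norml => /andP[? ?]; split; lra.
have cUN := within_reflect cU.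
(* Subtracting the equations at x and -x turns the reflected term into a multiple of the second
   derivative of the odd part, with total factor 1 + eps; adding them gives 1 - eps for the even
   part. *)
have odd0 : U x t - U (- x) t = 0.
  apply: (@heat_solution_unique _ (1 + eps) T (fun y => F y - F (- y))
    (fun y s => U y s - U (- y) s)) => //; last first.
    by move=> y ypi; have [-> ->] := U0 y ypi;
      have [-> ->] := U0 _ (oppi ypi); rewrite subrr.
  split.
  - exists (fun y s => Ux y s - (- Ux (- y) s)), (fun y s => Uxx y s - Uxx (- y) s),
      (fun y s => Ut y s - Ut (- y) s) => y s ys.
    have [a1 a2 a3 a4] := dU y s ys; have [b1 b2 b3 b4] := dUN y s ys.
    by split; [exact: is_deriveB|exact: is_deriveB|exact: is_deriveB|lra].
  - by move=> q; apply: cvgB; [exact: cU|exact: cUN].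
  - by move=> s sT; have [h1 h2] := Upi s sT; rewrite opprK h1 h2 subrr.
have even0 : U x t + U (- x) t = 0.
  apply: (@heat_solution_unique _ (1 - eps) T (fun y => F y + F (- y))
    (fun y s => U y s + U (- y) s)) => //; last first.
    by move=> y ypi; have [-> ->] := U0 y ypi;
      have [-> ->] := U0 _ (oppi ypi); rewrite addr0.
  split.
  - exists (fun y s => Ux y s + (- Ux (- y) s)), (fun y s => Uxx y s + Uxx (- y) s),
      (fun y s => Ut y s + Ut (- y) s) => y s ys.
    have [a1 a2 a3 a4] := dU y s ys; have [b1 b2 b3 b4] := dUN y s ys.
    by split; [exact: is_deriveD|exact: is_deriveD|exact: is_deriveD|lra].
  - by move=> q; apply: cvgD; [exact: cU|exact: cUN].
  - by move=> s sT; have [h1 h2] := Upi s sT; rewrite opprK h1 h2 addr0.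
by move: odd0 even0; lra.
Qed.

(** Once [u] and [v] agree, all derivatives of their difference vanish inside, and the equation at
    any single interior time forces f = g on the open interval; continuity settles the end
    points. *)
Lemma regular_solution_unique (phi psi : R -> R) (u v : R -> R -> R)
    (f g : R -> R) :
  regular_solution T eps phi psi u f -> regular_solution T eps phi psi v g ->
  (forall x t, Omega_bar T (x, t) -> u x t = v x t) /\
  (forall x, - pi <= x <= pi -> f x = g x).
Proof.
move=> [ux [uxx [ut [[du _] [cu [cf [eu [u0 upi]]]]]]]].
move=> [vx [vxx [vt [[dv _] [cv [cg [ev [v0 vpi]]]]]]]].
pose U x t := u x t - v x t.
pose Ux x t := ux x t - vx x t.
pose Uxx x t := uxx x t - vxx x t.
pose Ut x t := ut x t - vt x t.
have dU x t : Omega T (x, t) ->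
    [/\ is_derive x 1 (U ^~ t) (Ux x t), is_derive x 1 (Ux ^~ t) (Uxx x t),
        is_derive t 1 (U x) (Ut x t) &
        Ut x t - Uxx x t + eps * Uxx (- x) t = f x - g x].
  move=> Oxt; have [a1 [a2 a3]] := du x t Oxt; have [b1 [b2 b3]] := dv x t Oxt.
  split; try exact: is_deriveB.
  by rewrite -(eu x t Oxt) -(ev x t Oxt) /Ut /Uxx; ring.
have UE x t : Omega_bar T (x, t) -> U x t = 0.
  apply: (@reflected_heat_unique U Ux Uxx Ut _ dU).
  - by move=> q; apply: cvgB; [exact: cu|exact: cv].
  - by move=> y ypi; have [h1 h2] := u0 y ypi; have [h3 h4] := v0 y ypi;
      rewrite /U h1 h2 h3 h4 !subrr.
  - by move=> s sT; have [h1 h2] := upi s sT; have [h3 h4] := vpi s sT;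
      rewrite /U h1 h2 h3 h4 !subrr.
split=> [x t Oxt|x xpi]; apply/eqP; rewrite -subr_eq0; apply/eqP; first exact: UE.
have p0 := pi_gt0 R; have ltpi : - pi < (pi : R) by lra.
apply: (within_itv_eq0 ltpi (g := fun x => f x - g x)) xpi => [|y ypi].
  by move=> q; apply: cvgB; [exact: cf|exact: cg].
have [t tT] : exists t, 0 < t < T by exists (T / 2); move: T0; lra.
have in_pi (z w : R) : - pi < z < pi -> `|w - z| < Num.min (z + pi) (pi - z) ->
    - pi < w < pi.
  move=> _; rewrite lt_min => /andP[]; rewrite !ltr_norml => /andP[? ?] /andP[? ?].
  by apply/andP; split; lra.
have min0 (z : R) : - pi < z < pi -> 0 < Num.min (z + pi) (pi - z).
  by move=> /andP[? ?]; rewrite lt_min; apply/andP; split; lra.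
have U0 z s : - pi < z < pi -> 0 < s < T -> U z s = 0.
  by move=> /andP[? ?] /andP[? ?]; apply: UE; split=> /=; rewrite !ltW.
have Ux0 z : - pi < z < pi -> Ux z t = 0.
  move=> zpi; have [d _ _ _] := dU z t (conj zpi tT).
  by apply: (is_derive_locally0 (min0 _ zpi) _ d) => w /(in_pi _ _ zpi) wpi; exact: U0.
have Uxx0 z : - pi < z < pi -> Uxx z t = 0.
  move=> zpi; have [_ d _ _] := dU z t (conj zpi tT).
  by apply: (is_derive_locally0 (min0 _ zpi) _ d) => w /(in_pi _ _ zpi); exact: Ux0.
have Ut0 : Ut y t = 0.
  have [_ _ d _] := dU y t (conj ypi tT).
  have t0 : 0 < t by case/andP: tT.
  have e0 : 0 < Num.min t (T - t) by rewrite lt_min t0; case/andP: tT; lra.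
  apply: (is_derive_locally0 e0 _ d) => s.
  rewrite lt_min => /andP[]; rewrite !ltr_norml => /andP[? ?] /andP[? ?].
  by apply: U0 => //; apply/andP; split; lra.
have [_ _ _ <-] := dU y t (conj ypi tT).
by rewrite Ut0 (Uxx0 y ypi) (Uxx0 _ (oppi_lt ypi)) mulr0 subr0 addr0.
Qed.

End RegularUniqueness.

(** * Square-integrable functions and Bessel's inequality *)

Section RIntegrable.
Context {R : realType}.
Notation mu := (@lebesgue_measure R).
Implicit Types (D : set R) (f g h : R -> R).

Definition rintegrable D f := mu.-integrable D (EFin \o f).

Lemma rintegrableD D f g : measurable D -> rintegrable D f ->
  rintegrable D g -> rintegrable D (fun x => f x + g x).
Proof.
move=> mD fi gi; rewrite /rintegrable.
have -> : EFin \o (fun x => f x + g x) = ((EFin \o f) \+ (EFin \o g))%E by [].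
exact: integrableD.
Qed.

Lemma rintegrableB D f g : measurable D -> rintegrable D f ->
  rintegrable D g -> rintegrable D (fun x => f x - g x).
Proof.
move=> mD fi gi; rewrite /rintegrable.
have -> : EFin \o (fun x => f x - g x) = ((EFin \o f) \- (EFin \o g))%E by [].
exact: integrableB.
Qed.

Lemma rintegrableZ D f (c : R) : measurable D -> rintegrable D f ->
  rintegrable D (fun x => c * f x).
Proof.
move=> mD fi; rewrite /rintegrable.
have -> : EFin \o (fun x => c * f x) = (fun x => c%:E * (EFin \o f) x)%E by [].
exact: integrableZl.
Qed.

Lemma rintegrable_le D f g : measurable D -> measurable_fun D f ->
  (forall x, D x -> `|f x| <= g x) -> rintegrable D g -> rintegrable D f.
Proof.
move=> mD mf fg; apply: le_integrable => //; first exact/measurable_EFinP.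
move=> x Dx /=; rewrite lee_fin; apply: le_trans (fg x Dx) _.
exact: ler_norm.
Qed.

Lemma rintegrable_measurable D f : rintegrable D f -> measurable_fun D f.
Proof. by move=> /integrableP[mf _]; exact/measurable_EFinP. Qed.

Lemma rintegrable_norm D f : rintegrable D f ->
  rintegrable D (fun x => `|f x|).
Proof. by move=> fi; exact: (integrable_norm fi). Qed.

Lemma rintegrableM D f h (C : R) : measurable D -> rintegrable D f ->
  measurable_fun D h -> (forall x, D x -> `|h x| <= C) ->
  rintegrable D (fun x => f x * h x).
Proof.
move=> mD fi mh hC.
apply: (@rintegrable_le _ _ (fun x => C * `|f x|)) => //.
- by apply: measurable_funM => //; exact: rintegrable_measurable.
- by move=> x Dx; rewrite normrM mulrC ler_wpM2r// hC.
- by apply: rintegrableZ => //; exact: rintegrable_norm.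
Qed.

Lemma rintegrableS D E f : measurable D -> measurable E -> E `<=` D ->
  rintegrable D f -> rintegrable E f.
Proof. by move=> mD mE ED; exact: integrableS. Qed.

Lemma continuous_rintegrable (a b : R) f : {within `[a, b], continuous f} ->
  rintegrable `[a, b] f.
Proof.
move=> cf; apply: continuous_compact_integrable => //.
exact: segment_compact.
Qed.

Lemma Rintegral_FTC (a b : R) (f F : R -> R) : a < b -> continuous f ->
  (forall x : R, is_derive x 1 F (f x)) ->
  \int[mu]_(x in `[a, b]) f x = F b - F a.
Proof.
move=> ab cf dF; have cF : continuous F.
  move=> x; apply: differentiable_continuous; apply/derivable1_diffP.
  by have [] := dF x.
rewrite /Rintegral (continuous_FTC2 ab (F := F)) //.
- exact: continuous_subspaceT.
- split; first by move=> x _; have [] := dF x.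
    by apply: cvg_at_right_filter; exact: cF.
  by apply: cvg_at_left_filter; exact: cF.
- by move=> x _; rewrite derive1E; have [_ ->] := dF x.
Qed.

End RIntegrable.

(** * Orthogonality of shifted sine waves and Bessel's inequality *)

Section Bessel.
Context {R : realType}.
Notation mu := (@lebesgue_measure R).
Notation D := (`[- pi, (pi : R)]%classic).
Implicit Types (f g h : R -> R).

Definition square_integrable g :=
  measurable_fun D g /\ (\int[mu]_(x in D) ((g x) ^+ 2)%:E < +oo)%E.

Let mD : measurable D. Proof. exact: measurable_itv. Qed.

Lemma square_integrable_sqr g : square_integrable g ->
  rintegrable D (fun x => g x ^+ 2).
Proof.
move=> [mg gfin]; apply/integrableP; split.
  by apply/measurable_EFinP; exact: measurable_funX.
under eq_integral do rewrite /= ger0_norm ?sqr_ge0//.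
exact: gfin.
Qed.

Lemma square_integrable_integrable g : square_integrable g -> rintegrable D g.
Proof.
move=> hg; have [mg _] := hg.
apply: (@rintegrable_le _ _ _ (fun x => 1 + g x ^+ 2)) => //.
  move=> x _; rewrite ler_norml; have h1 := sqr_ge0 (g x - 1).
  have h2 := sqr_ge0 (g x + 1); rewrite sqrrB sqrrD in h1 h2.
  have h3 := sqr_ge0 (g x).
  by rewrite expr1n !mulr1 in h1 h2; apply/andP; split; lra.
apply: rintegrableD => //; last exact: square_integrable_sqr.
by apply: continuous_rintegrable; apply: continuous_subspaceT => x; exact: cvg_cst.
Qed.

Lemma continuous_square_integrable g : {within D, continuous g} ->
  square_integrable g.
Proof.
move=> cg; split.
  by apply: rintegrable_measurable; exact: continuous_rintegrable.
have : rintegrable D (fun x => g x ^+ 2).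
  by apply: continuous_rintegrable => x; exact: (cvgM (cg x) (cg x)).
move=> /integrableP[_]; under eq_integral do rewrite /= ger0_norm ?sqr_ge0//.
by [].
Qed.

(* The phases [th = 0] and [th = pi / 2] give the sine and the cosine modes. *)
Definition swave (w th x : R) := sin (w * x + th).

Lemma continuous_swave w th : continuous (swave w th).
Proof. exact: sin_affine_continuous. Qed.

Lemma measurable_swave w th : measurable_fun D (swave w th).
Proof.
by apply: measurable_funTS; apply: continuous_measurable_fun; exact: continuous_swave.
Qed.

Lemma swave_le1 w th x : `|swave w th x| <= 1.
Proof. exact: sin_max. Qed.

Lemma rintegrable_swave g w th : rintegrable D g ->
  rintegrable D (fun x => g x * swave w th x).
Proof.
move=> gi; apply: (@rintegrableM _ _ _ _ 1) => //; first exact: measurable_swave.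
by move=> x _; exact: swave_le1.
Qed.

Lemma square_integrable_swaveB g c w th : square_integrable g ->
  square_integrable (fun x => g x - c * swave w th x).
Proof.
move=> hg; have [mg _] := hg; split.
  apply: measurable_funB => //; apply: measurable_funM => //.
  exact: measurable_swave.
have : rintegrable D (fun x => (g x - c * swave w th x) ^+ 2).
  have -> : (fun x => (g x - c * swave w th x) ^+ 2) = (fun x =>
      (g x ^+ 2 - (2 * c) * (g x * swave w th x)) +
      c ^+ 2 * (swave w th x * swave w th x)).
    by apply/funext => x; ring.
  apply: rintegrableD => //.
    apply: rintegrableB => //; first exact: square_integrable_sqr.
    apply: rintegrableZ => //; apply: rintegrable_swave.
    exact: square_integrable_integrable.
  apply: rintegrableZ => //; apply: rintegrable_swave.
  apply: continuous_rintegrable; apply: continuous_subspaceT.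
  exact: continuous_swave.
move=> /integrableP[_]; under eq_integral do rewrite /= ger0_norm ?sqr_ge0//.
by [].
Qed.

(** This is Pythagoras for one mode: removing a component of amplitude c lowers the squared norm by
    pi c^2. *)
Lemma Rintegral_swaveB_sqr g c w th : square_integrable g ->
  \int[mu]_(x in D) swave w th x ^+ 2 = pi ->
  \int[mu]_(x in D) (g x * swave w th x) = pi * c ->
  \int[mu]_(x in D) ((g x - c * swave w th x) ^+ 2) =
  \int[mu]_(x in D) (g x ^+ 2) - pi * c ^+ 2.
Proof.
move=> hg sq gc; pose e := swave w th.
have ei : rintegrable D (fun x => e x * e x).
  apply: rintegrable_swave; apply: continuous_rintegrable.
  by apply: continuous_subspaceT; exact: continuous_swave.
have gei : rintegrable D (fun x => g x * e x).
  by apply: rintegrable_swave; exact: square_integrable_integrable.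
have -> : \int[mu]_(x in D) ((g x - c * swave w th x) ^+ 2) =
    \int[mu]_(x in D) ((g x ^+ 2 - (2 * c) * (g x * e x)) +
      c ^+ 2 * (e x * e x)).
  by apply: eq_Rintegral => x _; rewrite /e; ring.
have h1 := square_integrable_sqr hg.
have h2 := rintegrableZ (2 * c) mD gei.
have h3 := rintegrableZ (c ^+ 2) mD ei.
rewrite RintegralD//; last exact: rintegrableB.
rewrite RintegralB// !RintegralZl// gc.
have -> : \int[mu]_(x in D) (e x * e x) = pi.
  by rewrite -[RHS]sq; apply: eq_Rintegral => x _; rewrite expr2.
by ring.
Qed.

(** Modes are removed one at a time, which avoids expanding the square of a sum. The squared norm of
    each residual is non-negative, so the partial sums of c_k^2 are bounded by the squared norm of
    [g] divided by pi. *)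
Lemma bessel (w : nat -> R) (th : R) g (c : nat -> R) :
  (forall i j, \int[mu]_(x in D) (swave (w i) th x * swave (w j) th x) =
    if i == j then pi else 0) ->
  square_integrable g ->
  (forall k, \int[mu]_(x in D) (g x * swave (w k) th x) = pi * c k) ->
  cvgn (series (fun k => c k ^+ 2)).
Proof.
move=> orth hg gc.
(* [r] is the residual of [g] after removing its first [n] components *)
have res n : exists r, [/\ square_integrable r,
    forall j, (n <= j)%N -> \int[mu]_(x in D) (r x * swave (w j) th x) = pi * c j &
    \int[mu]_(x in D) (r x ^+ 2) = \int[mu]_(x in D) (g x ^+ 2)
      - pi * series (fun k => c k ^+ 2) n].
  elim: n => [|n [r [hr rj rn]]].
    by exists g; split=> //; rewrite /series/= big_geq// mulr0 subr0.
  exists (fun x => r x - c n * swave (w n) th x); split.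
  - exact: square_integrable_swaveB.
  - move=> j nj.
    have -> : \int[mu]_(x in D) ((r x - c n * swave (w n) th x) * swave (w j) th x)
       = \int[mu]_(x in D) (r x * swave (w j) th x -
           c n * (swave (w n) th x * swave (w j) th x)).
      by apply: eq_Rintegral => x _; ring.
    have h1 : rintegrable D (fun x => r x * swave (w j) th x).
      by apply: rintegrable_swave; exact: square_integrable_integrable.
    have h2 : rintegrable D (fun x => swave (w n) th x * swave (w j) th x).
      apply: rintegrable_swave; apply: continuous_rintegrable.
      by apply: continuous_subspaceT; exact: continuous_swave.
    rewrite RintegralB//; last exact: rintegrableZ.
    rewrite RintegralZl// orth ltn_eqF// mulr0 subr0 rj//.
    exact: ltnW.
  - rewrite (Rintegral_swaveB_sqr hr _ (rj n (leqnn n))) ?rn.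
      by rewrite seriesSr; ring.
    have := orth n n; rewrite eqxx => orthn; rewrite -[RHS]orthn.
    by apply: eq_Rintegral => x _; rewrite expr2.
apply: nondecreasing_is_cvgn.
  by apply: nondecreasing_series => k _ _; exact: sqr_ge0.
exists (\int[mu]_(x in D) (g x ^+ 2) / pi) => _ [n _ <-].
rewrite ler_pdivlMr ?pi_gt0// mulrC -subr_ge0.
have [r [_ _ <-]] := res n.
by apply: Rintegral_ge0 => x _; exact: sqr_ge0.
Qed.

Lemma sin_natpi n : sin (n%:R * pi) = 0 :> R.
Proof.
elim: n => [|n IH]; first by rewrite mul0r sin0.
by rewrite -natr1 mulrDl mul1r sinDpi IH oppr0.
Qed.

Lemma Rintegral_cos_nat n (ph : R) : (0 < n)%N ->
  \int[mu]_(x in D) cos (n%:R * x + ph) = 0.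
Proof.
move=> n0; have nN : n%:R != 0 :> R by rewrite pnatr_eq0 -lt0n.
have p0 := pi_gt0 R.
have dF (x : R) : is_derive x 1 (fun x => n%:R^-1 * sin (n%:R * x + ph))
    (cos (n%:R * x + ph)).
  rewrite -[cos _](mulKf nN).
  by apply: is_derive_scale; exact: is_derive_sin_affine.
have ab : - pi < (pi : R) by lra.
have cf : continuous (fun x : R => cos (n%:R * x + ph)).
  exact: cos_affine_continuous.
by rewrite (Rintegral_FTC ab cf dF) mulrN !sinD sinN cosN sin_natpi; ring.
Qed.

Lemma swaveM w1 w2 th x : swave w1 th x * swave w2 th x =
  2^-1 * cos ((w1 - w2) * x + 0) - 2^-1 * cos ((w1 + w2) * x + 2 * th) :> R.
Proof.
have -> : (w1 - w2) * x + 0 = (w1 * x + th) - (w2 * x + th) by ring.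
have -> : (w1 + w2) * x + 2 * th = (w1 * x + th) + (w2 * x + th) by ring.
by rewrite /swave cosB (cosD (_ + th)); field.
Qed.

(** The condition on s makes the sum of two frequencies a positive integer, while their difference
    is an integer too; cosines of non-zero integer frequency integrate to 0 over [-pi, pi]. The uses
    are s = 1/2 and s = 1, the latter starting the integer frequencies at 1 because frequency 0
    would break the norm pi. *)
Lemma swave_orthogonal (c : nat) (s th : R) : 2 * s = c.+1%:R -> forall i j,
  \int[mu]_(x in D) (swave (i%:R + s) th x * swave (j%:R + s) th x) =
    if i == j then pi else 0.
Proof.
move=> sc i j.
have ci (w ph : R) : rintegrable D (fun x => cos (w * x + ph)).
  apply: continuous_rintegrable; apply: continuous_subspaceT.
  exact: cos_affine_continuous.
under eq_Rintegral do rewrite swaveM.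
rewrite RintegralB//; [|exact: rintegrableZ..].
rewrite !RintegralZl//; [|exact: ci..].
have -> : i%:R + s + (j%:R + s) = (i + j + c.+1)%:R by rewrite !natrD -sc; ring.
rewrite (@Rintegral_cos_nat (i + j + c.+1)) ?addnS// mulr0 subr0.
have -> : i%:R + s - (j%:R + s) = i%:R - j%:R by ring.
have [ij|ij|->] := ltngtP i j.
- have -> : i%:R - j%:R = - (j - i)%:R :> R by rewrite natrB ?(ltnW ij)//; ring.
  have E x : cos (- (j - i)%:R * x + 0) = cos ((j - i)%:R * x + 0) :> R.
    by rewrite !addr0 mulNr cosN.
  under eq_Rintegral do rewrite E.
  by rewrite Rintegral_cos_nat ?mulr0// subn_gt0.
- by rewrite -natrB ?(ltnW ij)// Rintegral_cos_nat ?mulr0// subn_gt0.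
- rewrite subrr; under eq_Rintegral do rewrite mul0r addr0 cos0.
  have p0 := pi_gt0 R; have ab : - pi < (pi : R) by lra.
  by rewrite Rintegral_cst//= lebesgue_measure_itv/= lte_fin ab /=; field.
Qed.

Lemma bessel_swave (c : nat) (s th : R) g : 2 * s = c.+1%:R ->
  square_integrable g ->
  cvgn (series (fun k =>
    (pi^-1 * \int[mu]_(x in D) (g x * swave (k%:R + s) th x)) ^+ 2)).
Proof.
move=> sc hg; apply: (bessel (swave_orthogonal th sc) hg) => k.
by rewrite mulrA divff ?mul1r// gt_eqF// pi_gt0.
Qed.

(** For square-integrable [g] this follows from Bessel's inequality: the squared coefficients are
    the terms of a convergent series. *)
Lemma riemann_lebesgue (c : nat) (s th : R) g : 2 * s = c.+1%:R ->
  square_integrable g ->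
  \int[mu]_(x in D) (g x * swave (k%:R + s) th x) @[k --> \oo] --> 0.
Proof.
move=> sc hg; have /cvg_series_cvg_0 h := bessel_swave (th := th) sc hg.
apply/cvgr0Pnorm_lt => e e0.
have e1 : 0 < (e / pi) ^+ 2 by rewrite exprn_gt0// divr_gt0// pi_gt0.
move/cvgr0Pnorm_lt : h => /(_ _ e1); apply: filterS => k.
rewrite ger0_norm ?sqr_ge0// -[X in X < _]real_normK ?num_real//.
rewrite ltr_pXn2r ?nnegrE ?normr_ge0 ?divr_ge0 ?(ltW e0) ?pi_ge0//.
rewrite normrM normfV (@ger0_norm _ pi) ?pi_ge0// mulrC.
by rewrite ltr_pM2r// invr_gt0 pi_gt0.
Qed.

End Bessel.

(** * Integration by parts *)

Section ByParts.
Context {R : realType}.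
Notation mu := (@lebesgue_measure R).
Implicit Types (a b : R) (f g : R -> R).

(* Sum the bound over the uniform subdivision into n pieces: the result is
   C (b - a) (A b - A a) / n. *)
Lemma increments_eq (H A : R -> R) a b C : a <= b ->
  (forall x y, a <= x -> x < y -> y <= b ->
    `|H y - H x| <= C * (y - x) * (A y - A x)) ->
  H a = H b.
Proof.
rewrite le_eqVlt => /predU1P[->//|ab] HA.
pose B := C * (b - a) * (A b - A a).
have HB n : `|H b - H a| <= B / n.+1%:R.
  have n0 : 0 < n.+1%:R :> R by rewrite ltr0n.
  pose d := (b - a) / n.+1%:R.
  have d0 : 0 < d by rewrite divr_gt0// subr_gt0.
  pose X (m : nat) := a + m%:R * d.
  have Xn : X n.+1 = b by rewrite /X /d mulrC divfK ?gt_eqF// addrC subrK.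
  have step m : (m <= n.+1)%N -> `|H (X m) - H a| <= C * d * (A (X m) - A a).
    elim: m => [|m IH] mn.
      by rewrite /X mul0r addr0 !subrr normr0 mulr0.
    have XS : X m.+1 = X m + d by rewrite /X -natr1; ring.
    have aX : a <= X m by rewrite lerDl mulr_ge0// ltW.
    have Xb : X m.+1 <= b.
      by rewrite -Xn /X lerD2l ler_wpM2r ?(ltW d0)// ler_nat.
    have XX : X m < X m.+1 by rewrite XS ltrDl.
    have Xd : X m.+1 - X m = d by rewrite XS; ring.
    have := HA _ _ aX XX Xb; rewrite Xd => h1; have h2 := IH (ltnW mn).
    have -> : H (X m.+1) - H a = (H (X m.+1) - H (X m)) + (H (X m) - H a) by ring.
    apply: le_trans (ler_normD _ _) _; apply: le_trans (lerD h1 h2) _.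
    by rewrite -mulrDr; have -> : A (X m.+1) - A (X m) + (A (X m) - A a) =
      A (X m.+1) - A a by ring.
  have := step n.+1 (leqnn _); rewrite Xn; congr (_ <= _).
  by rewrite /B /d; field; rewrite gt_eqF.
apply/eqP; rewrite eq_sym -subr_eq0 -normr_le0 leNgt; apply/negP => e0.
have B0 : 0 <= B by have := HB 0%N; rewrite divr1; apply: le_trans.
have q0 : 0 <= B / `|H b - H a| by rewrite divr_ge0.
have /ltW := Num.Theory.archi_boundP q0; set n := Num.bound _ => Bn.
have := HB n; rewrite ler_pdivlMr ?ltr0n//; apply/negP; rewrite -ltNge.
rewrite -natr1 mulrDr mulr1; apply: (@le_lt_trans _ _ (`|H b - H a| * n%:R)).
  by rewrite mulrC -ler_pdivrMr.
by rewrite ltrDl.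
Qed.

Lemma Rintegral_increment f a b x y : rintegrable `[a, b] f ->
  a <= x -> x <= y -> y <= b ->
  \int[mu]_(z in `[a, y]) f z - \int[mu]_(z in `[a, x]) f z =
  \int[mu]_(z in `]x, y]) f z.
Proof.
move=> fi ax xy yb; apply: Rintegral_itvB; rewrite ?bnd_simp//.
apply: rintegrableS fi => //; apply: subset_itvl.
by rewrite bnd_simp.
Qed.

Lemma Rintegral_normr_le f g D : measurable D -> rintegrable D f ->
  rintegrable D g -> (forall z, D z -> `|f z| <= g z) ->
  `|\int[mu]_(z in D) f z| <= \int[mu]_(z in D) g z.
Proof.
move=> mD fi gi fg.
apply: (@le_trans _ _ (\int[mu]_(z in D) `|f z|)); first exact: le_normr_Rintegral.
by apply: le_Rintegral => //; exact: rintegrable_norm.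
Qed.

Lemma Rintegral_itv_cst (x y r : R) : x <= y ->
  \int[mu]_(z in `]x, y]) r = r * (y - x).
Proof.
move=> xy; rewrite Rintegral_cst//= lebesgue_measure_itv/= lte_fin.
by move: xy; rewrite le_eqVlt => /predU1P[->|->//]; rewrite ltxx subrr.
Qed.

(* Integration by parts for an absolutely continuous factor: the defect
   int g c - G c + int G c' has increments bounded by
   2 L (y - x) int_x^y |g|. *)
Lemma Rintegral_by_parts_ac a b L C g (c c' : R -> R) : a < b ->
  rintegrable `[a, b] g ->
  (forall x : R, is_derive x 1 c (c' x)) -> continuous c' ->
  (forall x, `|c x| <= C) -> (forall x, `|c' x| <= L) ->
  let G x := \int[mu]_(z in `[a, x]) g z in
  \int[mu]_(z in `[a, b]) (g z * c z) =
  G b * c b - \int[mu]_(z in `[a, b]) (G z * c' z).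
Proof.
move=> ab gi dc cc' cC c'L G.
have L0 : 0 <= L by apply: le_trans (c'L 0).
have cc : continuous c.
  by move=> x; apply: differentiable_continuous; apply/derivable1_diffP; have [] := dc x.
have lip z y : `|c z - c y| <= L * `|z - y|.
  have := @mvt_le _ c c' y (`|z - y| + 1) L (fun y _ => dc y) (fun y _ => c'L y) (z - y).
  by rewrite subrK; apply; rewrite ltrDl.
have mI : measurable (`[a, b] : set R) by exact: measurable_itv.
have gci : rintegrable `[a, b] (fun z => g z * c z).
  apply: (@rintegrableM _ _ _ _ C) => //.
  by apply: measurable_funTS; exact: continuous_measurable_fun.
have cG : {within `[a, b], continuous G}.
  exact: (parameterized_integral_continuous (ltW ab) gi).
have gni := rintegrable_norm gi.
have c'i : rintegrable `[a, b] c'.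
  by apply: continuous_rintegrable; exact: continuous_subspaceT.
have Gi : rintegrable `[a, b] G by exact: continuous_rintegrable.
have mc' D : measurable_fun D c'.
  by apply: measurable_funTS; exact: continuous_measurable_fun.
have mc D : measurable_fun D c.
  by apply: measurable_funTS; exact: continuous_measurable_fun.
have Gci : rintegrable `[a, b] (fun z => G z * c' z).
  by apply: (@rintegrableM _ _ _ _ L).
pose A x := \int[mu]_(z in `[a, x]) `|g z|.
pose K x := \int[mu]_(z in `[a, x]) (g z * c z) - G x * c x +
  \int[mu]_(z in `[a, x]) (G z * c' z).
have Gle x z : a <= x -> x <= z -> z <= b -> `|G z - G x| <= A z - A x.
  move=> ax xz zb; rewrite /G /A (Rintegral_increment gi)//.
  rewrite (Rintegral_increment gni)//; apply: le_normr_Rintegral => //.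
  apply: rintegrableS gi => //; apply: subset_itv; rewrite bnd_simp//.
have Amono x z : a <= x -> x <= z -> z <= b -> A x <= A z.
  move=> ax xz zb; rewrite -subr_ge0; apply: le_trans (Gle x z ax xz zb).
  exact: normr_ge0.
have /(increments_eq (ltW ab)) KE : forall x y, a <= x -> x < y -> y <= b ->
    `|K y - K x| <= (2 * L) * (y - x) * (A y - A x).
  move=> x y ax xy yb; have xy' := ltW xy.
  have JI : `]x, y] `<=` `[a, b] by apply: subset_itv; rewrite bnd_simp.
  have mJ : measurable (`]x, y] : set R) by exact: measurable_itv.
  have sub f : rintegrable `[a, b] f -> rintegrable `]x, y] f.
    exact: rintegrableS.
  have cJ : c y - c x = \int[mu]_(z in `]x, y]) c' z.
    rewrite -(Rintegral_FTC xy cc' dc) Rintegral_itv_obnd_cbnd//.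
    exact: sub.
  have gcy : rintegrable `]x, y] (fun z => c y * g z).
    by apply: rintegrableZ => //; exact: sub.
  have Gxc : rintegrable `]x, y] (fun z => G x * c' z).
    by apply: rintegrableZ => //; exact: sub.
  (* This rests on G y c y - G x c x = c y (G y - G x) + G x (c y - c x). What remains are the
     oscillations of c and of G on ]x, y], bounded by L (y - x) and by A y - A x. *)
  have KK : K y - K x =
      \int[mu]_(z in `]x, y]) (g z * c z - c y * g z) +
      \int[mu]_(z in `]x, y]) (G z * c' z - G x * c' z).
    rewrite !RintegralB//; [|exact: sub..].
    rewrite !RintegralZl//; [|exact: sub..].
    rewrite -cJ -!(Rintegral_increment _ ax xy' yb)//.
    by rewrite /K -/(G y) -/(G x); ring.
  rewrite KK; apply: le_trans (ler_normD _ _) _.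
  have -> : 2 * L * (y - x) * (A y - A x) =
      L * (y - x) * (A y - A x) + L * (A y - A x) * (y - x) by ring.
  apply: lerD.
  - rewrite {2}/A (Rintegral_increment gni)// -RintegralZl//; last exact: sub.
    apply: Rintegral_normr_le => //.
    + by apply: rintegrableB => //; exact: sub.
    + by apply: rintegrableZ => //; exact: sub.
    move=> z /=; rewrite in_itv/= => /andP[xz zy].
    have -> : g z * c z - c y * g z = (c z - c y) * g z by ring.
    rewrite normrM ler_wpM2r//; apply: le_trans (lip z y) _.
    by rewrite ler_wpM2l// ler_norml; apply/andP; split; lra.
  - rewrite -(Rintegral_itv_cst _ xy').
    apply: Rintegral_normr_le => //.
    + by apply: rintegrableB => //; exact: sub.
    + by apply: sub; apply: continuous_rintegrable;
        apply: continuous_subspaceT => z; exact: cvg_cst.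
    move=> z /=; rewrite in_itv/= => /andP[xz zy]; have xz' := ltW xz.
    have zb := le_trans zy yb; have az := le_trans ax xz'.
    rewrite -mulrBl normrM mulrC; apply: ler_pM => //.
    apply: le_trans (Gle x z ax xz' zb) _.
    by rewrite lerD2r Amono.
have Ka : K a = 0.
  by rewrite /K /G set_itv1 !Rintegral_set1 mul0r subr0 addr0.
by move: KE; rewrite Ka /K => /eqP; rewrite eq_sym => /eqP; lra.
Qed.

End ByParts.

(** * Pointwise convergence of the Fourier series *)

Section SineCoefficients.
Context {R : realType}.
Notation mu := (@lebesgue_measure R).
Notation D := (`[- pi, (pi : R)]%classic).
Implicit Types (f g h : R -> R).

Let ltpi : - pi < (pi : R).
Proof. by have p0 := pi_gt0 R; lra. Qed.

Let mD : measurable D. Proof. exact: measurable_itv. Qed.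

Lemma Rintegral_by_parts_C1 (e e' G g : R -> R) :
  (forall x : R, is_derive x 1 e (e' x)) -> continuous e' ->
  (forall x, - pi < x < pi -> is_derive x 1 G (g x)) ->
  {within D, continuous G} -> {within D, continuous g} ->
  \int[mu]_(x in D) (e x * g x) =
  e pi * G pi - e (- pi) * G (- pi) - \int[mu]_(x in D) (e' x * G x).
Proof.
move=> de ce' dG cG cg; have ce : continuous e.
  by move=> x; apply: differentiable_continuous; apply/derivable1_diffP; have [] := de x.
apply: Rintegration_by_parts => //.
- exact: continuous_subspaceT.
- split; first by move=> x _; have [] := de x.
    by apply: cvg_at_right_filter; exact: ce.
  by apply: cvg_at_left_filter; exact: ce.
- by move=> x _; rewrite derive1E; have [_ ->] := de x.
- have [_ c1 c2] := (continuous_within_itvP G ltpi).1 cG.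
  by split=> // x; rewrite in_itv/= => /dG[].
- by move=> x; rewrite in_itv/= => /dG[_ h]; rewrite derive1E h.
Qed.

Lemma is_derive_swave (w th x : R) :
  is_derive x 1 (swave w th) (w * cos (w * x + th)).
Proof. exact: is_derive_sin_affine. Qed.

(** Three integrations by parts. The boundary terms vanish in turn through [g2], through the mode
    itself and through [g], so the end values of [g1], which are not prescribed, never enter. *)
Lemma third_derivative_coef (w th : R) (g g1 g2 g3 : R -> R) :
  swave w th pi = 0 -> swave w th (- pi) = 0 ->
  C2_on (- pi) pi g g1 g2 -> deriv_L2 (- pi) pi g2 g3 ->
  g (- pi) = 0 -> g pi = 0 -> g2 (- pi) = 0 -> g2 pi = 0 ->
  \int[mu]_(x in D) (g3 x * cos (w * x + th)) =
  - w ^+ 3 * \int[mu]_(x in D) (g x * swave w th x).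
Proof.
move=> sp sm [dg [cg [cg1 cg2]]] [mg3 [g3fin g2E]] gm gp g2m g2p.
have g3i : rintegrable D g3 by apply: square_integrable_integrable; split.
pose c x := cos (w * x + th); pose c' x := w * - sin (w * x + th).
have dc (x : R) : is_derive x 1 c (c' x) by exact: is_derive_cos_affine.
have cc : continuous c by exact: cos_affine_continuous.
have cs : continuous (swave w th) by exact: continuous_swave.
have cc' : continuous c'.
  by move=> x; apply: cvgM; [exact: cvg_cst|apply: cvgN; exact: cs].
have wsi f : {within D, continuous f} -> rintegrable D (fun x => f x * swave w th x).
  by move=> cf; apply: rintegrable_swave; exact: continuous_rintegrable.
have wci f : {within D, continuous f} -> rintegrable D (fun x => f x * c x).
  move=> cf; apply: (@rintegrableM _ _ _ _ 1) => //.
  - exact: continuous_rintegrable.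
  - by apply: measurable_funTS; exact: continuous_measurable_fun.
  - by move=> x _; exact: cos_max.
have step1 : \int[mu]_(x in D) (g3 x * c x) =
    w * \int[mu]_(x in D) (g2 x * swave w th x).
  rewrite (@Rintegral_by_parts_ac _ _ _ `|w| 1 g3 c c' ltpi g3i dc cc').
  (* As [g2] vanishes at -pi, the indefinite integral of [g3] is [g2] itself. *)
  - rewrite -[X in X * _ - _](_ : g2 pi = _); last first.
      by rewrite g2E ?g2m ?add0r// lexx andbT ltW.
    rewrite g2p mul0r sub0r -RintegralZl//; last exact: wsi.
    rewrite -mulN1r -RintegralZl//.
      apply: eq_Rintegral => x; rewrite inE/= in_itv/= => xD.
      by rewrite (g2E x xD) g2m add0r /c' /swave; ring.
    apply: (@rintegrableM _ _ _ _ `|w|) => //.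
    + apply: continuous_rintegrable.
      exact: (parameterized_integral_continuous (ltW ltpi) g3i).
    + by apply: measurable_funTS; exact: continuous_measurable_fun.
    + by move=> x _; rewrite normrM normrN ler_piMr// sin_max.
  - by move=> x; exact: cos_max.
  - by move=> x; rewrite normrM normrN ler_piMr// sin_max.
have step2 : \int[mu]_(x in D) (g2 x * swave w th x) =
    - w * \int[mu]_(x in D) (g1 x * c x).
  have cwc : continuous (fun x => w * c x).
    by move=> x; apply: cvgM; [exact: cvg_cst|exact: cc].
  have := Rintegral_by_parts_C1 (is_derive_swave w th) cwc
    (fun x xpi => (dg x xpi).2) cg1 cg2.
  rewrite sp sm !mul0r subrr sub0r => H.
  under eq_Rintegral do rewrite mulrC.
  rewrite H.
  rewrite mulNr -RintegralZl//; last exact: wci.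
  by congr (- _); apply: eq_Rintegral => x _; rewrite /c; ring.
have step3 : \int[mu]_(x in D) (g1 x * c x) =
    w * \int[mu]_(x in D) (g x * swave w th x).
  have := Rintegral_by_parts_C1 dc cc' (fun x xpi => (dg x xpi).1) cg cg1.
  rewrite gp gm !mulr0 subrr sub0r => H.
  under eq_Rintegral do rewrite mulrC.
  rewrite H.
  rewrite -RintegralZl//; last exact: wsi.
  have ci : rintegrable D (fun x => c' x * g x).
    apply: continuous_rintegrable => x; apply: cvgM; last exact: cg.
    exact: (continuous_subspaceT cc').
  rewrite -mulN1r -RintegralZl//.
  by apply: eq_Rintegral => x _; rewrite /c' /swave; ring.
by rewrite step1 step2 step3; ring.
Qed.

(** The factor 1 / pi is left out here and restored in [fourier_pointwise]. *)
Definition scoef f (k : nat) := \int[mu]_(x in D) (f x * swave k%:R 0 x).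
Definition ccoef f (k : nat) :=
  \int[mu]_(x in D) (f x * swave (k%:R + 2^-1) (pi / 2) x).

Lemma swave_sin (w x : R) : swave w 0 x = sin (w * x).
Proof. by rewrite /swave addr0. Qed.

Lemma swave_cos (w x : R) : swave w (pi / 2) x = cos (w * x).
Proof. by rewrite /swave sinDpihalf. Qed.

(** Both families are cut at the same index: the telescoping passes back and forth between them. *)
Definition fourier_sum f (x0 : R) (n : nat) :=
  series (fun k => scoef f k * sin (k%:R * x0)) n.+1 +
  series (fun k => ccoef f k * cos ((k%:R + 2^-1) * x0)) n.+1.

(** Multiplication by sin(x/2) moves a frequency by one half and thus exchanges the two families,
    which is the source of the telescoping. *)
Lemma cos_half_shift (n : nat) (x : R) :
  cos ((n%:R + 2^-1) * x) =
  cos ((n.+1%:R + 2^-1) * x) + 2 * sin (2^-1 * x) * sin (n.+1%:R * x).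
Proof.
have -> : (n%:R + 2^-1) * x = n.+1%:R * x - 2^-1 * x by rewrite -natr1; field.
have -> : (n.+1%:R + 2^-1) * x = n.+1%:R * x + 2^-1 * x by ring.
by rewrite cosB cosD; ring.
Qed.

Lemma sin_half_shift (n : nat) (x : R) :
  sin (n.+1%:R * x) =
  sin (n%:R * x) + 2 * sin (2^-1 * x) * cos ((n%:R + 2^-1) * x).
Proof.
have -> : n.+1%:R * x = (n%:R + 2^-1) * x + 2^-1 * x by rewrite -natr1; field.
have -> : n%:R * x = (n%:R + 2^-1) * x - 2^-1 * x by field.
by rewrite sinB sinD; ring.
Qed.

(* Chernoff's argument: if [h = q (sin(x/2) - sin(x0/2))] then the partial sums
   of the Fourier series of [h] at [x0] telescope to two coefficients of [q]. *)
Section Telescope.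
Variables (q : R -> R) (x0 : R).
Hypothesis qi : rintegrable D q.
Let h x := q x * (sin (2^-1 * x) - sin (2^-1 * x0)).

Let qsi w th : rintegrable D (fun x => q x * swave w th x).
Proof. exact: rintegrable_swave. Qed.

Lemma scoef_telescope k : scoef h k.+1 =
  2^-1 * (ccoef q k - ccoef q k.+1) - sin (2^-1 * x0) * scoef q k.+1.
Proof.
have -> : scoef h k.+1 = \int[mu]_(x in D) (2^-1 *
      (q x * swave (k%:R + 2^-1) (pi / 2) x -
       q x * swave (k.+1%:R + 2^-1) (pi / 2) x) -
      sin (2^-1 * x0) * (q x * swave k.+1%:R 0 x)).
  apply: eq_Rintegral => x _; rewrite !swave_cos swave_sin (cos_half_shift k x).
  by rewrite /h; field.
rewrite RintegralB//; [|by apply: rintegrableZ => //; exact: rintegrableB|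
  exact: rintegrableZ].
rewrite RintegralZl//; last exact: qsi.
rewrite RintegralZl//; last exact: rintegrableB.
by rewrite RintegralB//; exact: qsi.
Qed.

Lemma ccoef_telescope k : ccoef h k =
  2^-1 * (scoef q k.+1 - scoef q k) - sin (2^-1 * x0) * ccoef q k.
Proof.
have -> : ccoef h k = \int[mu]_(x in D) (2^-1 *
      (q x * swave k.+1%:R 0 x - q x * swave k%:R 0 x) -
      sin (2^-1 * x0) * (q x * swave (k%:R + 2^-1) (pi / 2) x)).
  apply: eq_Rintegral => x _; rewrite swave_cos !swave_sin (sin_half_shift k x).
  by rewrite /h; field.
rewrite RintegralB//; [|by apply: rintegrableZ => //; exact: rintegrableB|
  exact: rintegrableZ].
rewrite RintegralZl//; last exact: qsi.
rewrite RintegralZl//; last exact: rintegrableB.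
by rewrite RintegralB//; exact: qsi.
Qed.

Lemma scoef0 f : scoef f 0 = 0.
Proof.
rewrite /scoef; under eq_Rintegral do rewrite swave_sin mul0r sin0 mulr0.
by rewrite Rintegral_cst// mul0r.
Qed.

(** The shift identities are used under the integral in x and again at [x0]; all interior terms
    cancel. At the lower end the sine of frequency 0 contributes nothing, so only the truncation
    index survives. *)
Lemma fourier_sum_telescope n : fourier_sum h x0 n =
  2^-1 * (scoef q n.+1 * cos ((n%:R + 2^-1) * x0) -
          ccoef q n * sin (n.+1%:R * x0)).
Proof.
rewrite /fourier_sum; elim: n => [|n IH].
  rewrite /series/= !big_nat1 mul0r sin0 mulr0 add0r ccoef_telescope.
  rewrite scoef0 (sin_half_shift 0 x0) mul0r sin0 add0r.
  by rewrite !add0r; field.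
rewrite seriesSr (seriesSr _ n.+1) addrACA IH.
rewrite scoef_telescope ccoef_telescope.
rewrite (cos_half_shift n x0) (sin_half_shift n.+1 x0).
by field.
Qed.

Lemma fourier_sum_telescope_cvg0 : square_integrable q ->
  fourier_sum h x0 n @[n --> \oo] --> 0.
Proof.
move=> hq.
have h1 : scoef q n.+1 @[n --> \oo] --> 0.
  have e1 : 2 * 1 = 2%:R :> R by rewrite mulr1.
  rewrite /scoef; under eq_fun do rewrite -natr1.
  exact: (riemann_lebesgue (c := 1) 0 e1 hq).
have h2 : ccoef q n @[n --> \oo] --> 0.
  have e1 : 2 * 2^-1 = 1%:R :> R by rewrite divff.
  exact: (riemann_lebesgue (c := 0) (pi / 2) e1 hq).
apply/cvgr0Pnorm_lt => e e0.
move/cvgr0Pnorm_lt : h1 => /(_ _ e0) h1; move/cvgr0Pnorm_lt : h2 => /(_ _ e0) h2.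
apply: filterS2 h1 h2 => n h1 h2.
rewrite fourier_sum_telescope normrM (@ger0_norm _ 2^-1)//.
have k1 : `|scoef q n.+1 * cos ((n%:R + 2^-1) * x0)| < e.
  by rewrite normrM; apply: le_lt_trans h1; rewrite ler_piMr// cos_max.
have k2 : `|ccoef q n * sin (n.+1%:R * x0)| < e.
  by rewrite normrM; apply: le_lt_trans h2; rewrite ler_piMr// sin_max.
have := ler_normB (scoef q n.+1 * cos ((n%:R + 2^-1) * x0))
  (ccoef q n * sin (n.+1%:R * x0)).
by lra.
Qed.

End Telescope.

(** The hypothesis covers k + 1/2 and k - 1/2 at once. The frequency is non-zero, since otherwise 2
    k = 1, and the antiderivative is an even function. *)
Lemma Rintegral_sin_half (k : nat) (s : R) : `|s| = 2^-1 ->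
  \int[mu]_(x in D) sin ((k%:R + s) * x + 0) = 0.
Proof.
move=> sE; have w0 : k%:R + s != 0.
  rewrite addr_eq0; apply/eqP => ks; have : `|s| = k%:R.
    by rewrite -normrN -ks normr_nat.
  rewrite sE => k2; have : (2 * k)%:R = 1%:R :> R.
    by rewrite natrM -k2 divff.
  by move/eqP; rewrite eqr_nat => /eqP; case: (k) => // j; rewrite mulnS.
set w := k%:R + s in w0 *.
have dF (x : R) : is_derive x 1 (fun x => - w^-1 * cos (w * x + 0))
    (sin (w * x + 0)).
  have -> : sin (w * x + 0) = - w^-1 * (w * - sin (w * x + 0)) by field.
  by apply: is_derive_scale; exact: is_derive_cos_affine.
have cf : continuous (fun x : R => sin (w * x + 0)) by exact: continuous_swave.
by rewrite (Rintegral_FTC ltpi cf dF) mulrN !addr0 cosN subrr.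
Qed.

Lemma scoef_cos_half k : scoef (fun x => cos (2^-1 * x)) k = 0.
Proof.
rewrite /scoef.
have E (x : R) : cos (2^-1 * x) * swave k%:R 0 x =
    2^-1 * sin ((k%:R + 2^-1) * x + 0) + 2^-1 * sin ((k%:R + - 2^-1) * x + 0).
  have -> : (k%:R + 2^-1) * x + 0 = k%:R * x + 2^-1 * x by ring.
  have -> : (k%:R + - 2^-1) * x + 0 = k%:R * x - 2^-1 * x by ring.
  by rewrite swave_sin sinD sinB; field.
under eq_Rintegral do rewrite E.
have si w : rintegrable D (fun x => sin (w * x + 0)).
  apply: continuous_rintegrable; apply: continuous_subspaceT.
  exact: continuous_swave.
rewrite RintegralD//; [|exact: rintegrableZ..].
rewrite !RintegralZl//; [|exact: si..].
have n1 : `|2^-1| = 2^-1 :> R by rewrite ger0_norm.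
have n2 : `|- 2^-1| = 2^-1 :> R by rewrite normrN n1.
by rewrite (Rintegral_sin_half k n1) (Rintegral_sin_half k n2) !mulr0 addr0.
Qed.

Lemma ccoef_cos_half k : ccoef (fun x => cos (2^-1 * x)) k =
  if k == 0%N then pi else 0.
Proof.
have e1 : 2 * 2^-1 = 1%:R :> R by rewrite divff.
have := swave_orthogonal (c := 0) (pi / 2) e1 k 0%N.
rewrite add0r => <-; apply: eq_Rintegral => x _.
by rewrite mulrC -swave_cos.
Qed.

(** As the lowest cosine mode, cos(x/2) is reproduced exactly by each partial sum; being also
    positive inside ]-pi, pi[, it can be used to make a function vanish at [x0]. *)
Lemma fourier_sum_cos_half x0 n :
  fourier_sum (fun x => cos (2^-1 * x)) x0 n = pi * cos (2^-1 * x0).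
Proof.
rewrite /fourier_sum /series/= big1 ?add0r; last first.
  by move=> k _; rewrite scoef_cos_half mul0r.
rewrite big_nat_recl// ccoef_cos_half eqxx big1 ?addr0 ?add0r// => k _.
by rewrite ccoef_cos_half mul0r.
Qed.

Lemma fourier_sumB f g x0 n : rintegrable D f -> rintegrable D g ->
  fourier_sum (fun x => f x - g x) x0 n = fourier_sum f x0 n - fourier_sum g x0 n.
Proof.
move=> fi gi; rewrite /fourier_sum /series/=.
have -> : forall a b c d : R, a + b - (c + d) = (a - c) + (b - d) by move=> *; ring.
rewrite -!sumrB; congr (_ + _); apply: eq_bigr => k _; rewrite -mulrBl.
- rewrite /scoef -RintegralB//; [|exact: rintegrable_swave..].
  by congr (_ * _); apply: eq_Rintegral => x _; rewrite mulrBl.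
- rewrite /ccoef -RintegralB//; [|exact: rintegrable_swave..].
  by congr (_ * _); apply: eq_Rintegral => x _; rewrite mulrBl.
Qed.

Lemma fourier_sumZ c f x0 n : rintegrable D f ->
  fourier_sum (fun x => c * f x) x0 n = c * fourier_sum f x0 n.
Proof.
move=> fi; rewrite /fourier_sum /series/= mulrDr !mulr_sumr.
congr (_ + _); apply: eq_bigr => k _; rewrite mulrA; congr (_ * _).
- rewrite /scoef -RintegralZl//; last exact: rintegrable_swave.
  by apply: eq_Rintegral => x _; rewrite mulrA.
- rewrite /ccoef -RintegralZl//; last exact: rintegrable_swave.
  by apply: eq_Rintegral => x _; rewrite mulrA.
Qed.

(* Subtracting a multiple of [cos(x/2)] makes [g] vanish at [x0]; the quotient
   by [sin(x/2) - sin(x0/2)] is then continuous on [[-pi, pi]]. *)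
Lemma fourier_pointwise g (x0 l : R) : - pi < x0 < pi ->
  {within D, continuous g} -> is_derive x0 1 g l ->
  pi^-1 * fourier_sum g x0 n @[n --> \oo] --> g x0.
Proof.
move=> x0pi cg dg.
have half (x : R) : - pi <= x <= pi -> 2^-1 * x \in `[- (pi / 2), pi / 2].
  by rewrite in_itv/= => /andP[? ?]; apply/andP; split; lra.
have c0 : 0 < cos (2^-1 * x0).
  by apply: cos_gt0_pihalf; case/andP: x0pi => ? ?; apply/andP; split; lra.
have cN : cos (2^-1 * x0) != 0 by rewrite gt_eqF.
pose a := g x0 / cos (2^-1 * x0).
pose f x := g x - a * cos (2^-1 * x).
have f0 : f x0 = 0 by rewrite /f /a divfK ?subrr// gt_eqF.
have cosE : (fun x : R => cos (2^-1 * x)) = (fun x => cos (2^-1 * x + 0)).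
  by apply/funext => x; rewrite addr0.
have sinE : (fun x : R => sin (2^-1 * x)) = (fun x => sin (2^-1 * x + 0)).
  by apply/funext => x; rewrite addr0.
have ch : continuous (fun x : R => cos (2^-1 * x)).
  by rewrite cosE; exact: cos_affine_continuous.
have csn : continuous (fun x : R => sin (2^-1 * x)).
  by rewrite sinE; exact: continuous_swave.
have cf : {within D, continuous f}.
  move=> x; apply: cvgB; first exact: cg.
  apply: cvgM; first exact: cvg_cst.
  exact: (continuous_subspaceT ch).
have df : is_derive x0 1 f (l - a * (2^-1 * - sin (2^-1 * x0))).
  apply: is_deriveB; apply: is_derive_scale.
  by have := @is_derive_cos_affine R 2^-1 0 x0; rewrite -cosE addr0.
have ds : is_derive x0 1 (fun x => sin (2^-1 * x)) (2^-1 * cos (2^-1 * x0)).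
  by have := @is_derive_sin_affine R 2^-1 0 x0; rewrite -sinE addr0.
(* The Caratheodory slopes [G1] and [G2] of f and of sin(x/2) at [x0] are continuous there. Since G2
   x0 = cos(x0/2) / 2 is not 0, their quotient is continuous at [x0] without a case distinction. *)
have [G1 [G1E cG1 G1x0]] := (is_derive1_caratheodory _ _ _).1 df.
have [G2 [G2E cG2 G2x0]] := (is_derive1_caratheodory _ _ _).1 ds.
have G2x0N : G2 x0 != 0 by rewrite G2x0 mulf_neq0// gt_eqF.
have x0pi' : - pi <= x0 <= pi by case/andP: x0pi => ? ?; rewrite !ltW.
have sN x : - pi <= x <= pi -> x != x0 -> sin (2^-1 * x) - sin (2^-1 * x0) != 0.
  move=> xpi; apply: contra => /eqP/subr0_eq.
  have h2 : 2^-1 != 0 :> R by [].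
  by move/(sin_inj (half _ xpi) (half _ x0pi')) => /(mulfI h2) ->.
pose q x := G1 x / G2 x.
have qE x : x != x0 -> q x = f x / (sin (2^-1 * x) - sin (2^-1 * x0)).
  move=> xx0; have xx : x - x0 != 0 by rewrite subr_eq0.
  (* Outside [-pi, pi] the slope [G2] may vanish; both sides are then 0, by the convention that the
     inverse of 0 is 0. *)
  rewrite G2E -[f x](subr0) -f0 G1E /q; have [->|G2N] := eqVneq (G2 x) 0.
    by rewrite mul0r invr0 !mulr0.
  by field; rewrite xx.
have cq : {within D, continuous q}.
  apply/subspace_continuousP => x; rewrite /= in_itv/= => xpi.
  have [->|xx0] := eqVneq x x0.
    by apply: cvg_within_filter; apply: cvgM => //; exact: cvgV.
  have neN : \forall y \near within D (nbhs x), y != x0.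
    apply: cvg_within; have : \forall y \near x, y != x0.
      by apply: open_nbhs_nbhs; split=> //; exact: open_neq.
    by [].
  suff : f y / (sin (2^-1 * y) - sin (2^-1 * x0)) @[y --> within D (nbhs x)] -->
      q x.
    apply: cvg_trans; apply: near_eq_cvg; apply: filterS neN => y yx0.
    exact/esym/qE.
  rewrite [X in _ --> X](qE x xx0).
  apply: cvgM; first by move/subspace_continuousP : cf; apply; rewrite /= in_itv.
  apply: cvgV; first exact: sN.
  apply: cvgB; last exact: cvg_cst.
  by apply: cvg_within_filter; exact: csn.
have hq := continuous_square_integrable cq.
have qi := square_integrable_integrable hq.
have := fourier_sum_telescope_cvg0 x0 qi hq.
have gE x : x \in D -> q x * (sin (2^-1 * x) - sin (2^-1 * x0)) = f x.
  rewrite inE/= in_itv/= => xpi; have [->|xx0] := eqVneq x x0.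
    by rewrite subrr mulr0 f0.
  by rewrite qE// divfK// sN.
have -> : fourier_sum (fun x => q x * (sin (2^-1 * x) - sin (2^-1 * x0))) x0 =
    fourier_sum f x0.
  apply/funext => n; rewrite /fourier_sum; congr (_ + _);
    congr (series _ _); apply/funext => k; congr (_ * _);
    by apply: eq_Rintegral => x xD; rewrite gE.
have gi : rintegrable D g by exact: continuous_rintegrable.
have hi : rintegrable D (fun x => cos (2^-1 * x)).
  by apply: continuous_rintegrable; exact: continuous_subspaceT.
move=> fc; have pN : pi != 0 :> R by rewrite gt_eqF// pi_gt0.
have -> : (fun n => pi^-1 * fourier_sum g x0 n) =
    (fun n => pi^-1 * fourier_sum f x0 n + g x0).
  apply/funext => n; rewrite /f fourier_sumB//; last exact: rintegrableZ.
  rewrite fourier_sumZ// fourier_sum_cos_half mulrBr (mulrCA a) mulKf//.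
  by rewrite /a divfK// subrK.
rewrite -[X in _ --> X]add0r -[X in X + _](mulr0 pi^-1).
by apply: cvgD; [apply: cvgM; [exact: cvg_cst|exact: fc]|exact: cvg_cst].
Qed.

End SineCoefficients.

(** * The solution *)

Section Coefficients.
Context {R : realType}.
Notation mu := (@lebesgue_measure R).
Notation D := (`[- pi, (pi : R)]%classic).

Lemma cvg_series_shift (u : nat -> R) :
  cvgn (series (fun k => u k.+1)) -> cvgn (series u).
Proof.
move=> /cvg_ex[l ul]; apply/cvg_ex; exists (u 0%N + l).
rewrite -cvg_shiftS.
have -> : [sequence series u n.+1]_n = fun n => u 0%N + series (fun k => u k.+1) n.
  by apply/funext => n; rewrite /series/= big_nat_recl.
by apply: cvgD; [exact: cvg_cst|exact: ul].
Qed.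

(** The induction carries the sharper bound 2 - 1/m for the sum up to 1/m^2; its step is 1/(m + 1)^2
    <= 1/m - 1/(m + 1). *)
Lemma cvg_series_inv_sqr : cvgn (series (fun k => (k.+1%:R : R) ^- 2)).
Proof.
apply: nondecreasing_is_cvgn.
  by apply: nondecreasing_series => k _ _; rewrite invr_ge0 sqr_ge0.
exists 2 => _ [n _ <-].
suff H : series (fun k => (k.+1%:R : R) ^- 2) n.+1 <= 2 - n.+1%:R^-1.
  case: n H => [|n] H; first by rewrite /series/= big_geq.
  have : series (fun k => (k.+1%:R : R) ^- 2) n.+1 <=
      series (fun k => (k.+1%:R : R) ^- 2) n.+2.
    by rewrite (seriesSr _ n.+1) lerDl invr_ge0 sqr_ge0.
  by move=> h; apply: le_trans h _; apply: le_trans H _; rewrite gerBl invr_ge0.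
elim: n => [|n IH]; first by rewrite /series/= big_nat1 expr1n invr1; lra.
rewrite seriesSr; apply: le_trans (lerD IH (lexx _)) _.
have n1 : 0 < n.+1%:R :> R by rewrite ltr0n.
have -> : n.+2%:R = n.+1%:R + 1 :> R by rewrite -natr1.
move: n1; set m : R := n.+1%:R => m0.
rewrite -subr_ge0.
have -> : 2 - (m + 1)^-1 - (2 - m^-1 + (m + 1) ^- 2) = (m * (m + 1) ^+ 2)^-1.
  by field; apply/andP; split; rewrite gt_eqF//; lra.
by rewrite invr_ge0 mulr_ge0 ?sqr_ge0// ltW.
Qed.

(** Each term is |c| / om, at most c^2 + 1/om^2, and the lower bound on om makes the second part at
    most 4 / (k + 1)^2. The bound (k + 1)/2 suits both k for k >= 1 and k + 1/2; a frequency 0 gives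
    the term 0. *)
Lemma cvg_mode_coefs (c om : nat -> R) : cvgn (series (fun k => c k ^+ 2)) ->
  (forall k, 2^-1 * k.+1%:R <= om k \/ om k = 0) ->
  cvgn (series (fun k => om k ^+ 2 * `|c k / om k ^+ 3|)).
Proof.
move=> cc omk.
have cM : cvgn (series (fun k => c k ^+ 2 + 4 * (k.+1%:R : R) ^- 2)).
  have -> : series (fun k => c k ^+ 2 + 4 * (k.+1%:R : R) ^- 2) =
     (fun n => series (fun k => c k ^+ 2) n +
       4 * series (fun k => (k.+1%:R : R) ^- 2) n).
    by apply/funext => n; rewrite /series/= mulr_sumr -big_split.
  apply: is_cvgD => //; apply: is_cvgM; first exact: is_cvg_cst.
  exact: cvg_series_inv_sqr.
apply: cvg_series_dominated cM _ => k.
have rhs0 : 0 <= c k ^+ 2 + 4 * k.+1%:R ^- 2.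
  by rewrite addr_ge0 ?sqr_ge0// mulr_ge0// invr_ge0 sqr_ge0.
rewrite ger0_norm; last by rewrite mulr_ge0// sqr_ge0.
case: (omk k) => [ok|->]; last by rewrite expr0n/= mul0r.
have k0 : 0 < k.+1%:R :> R by rewrite ltr0n.
have o0 : 0 < om k by apply: lt_le_trans ok; rewrite mulr_gt0.
rewrite normrM normfV (@ger0_norm _ (om k ^+ 3)); last by rewrite exprn_ge0// ltW.
have -> : om k ^+ 2 * (`|c k| / om k ^+ 3) = `|c k| * (om k)^-1.
  by field; rewrite gt_eqF.
have ov : (om k)^-1 <= 2 * k.+1%:R^-1.
  have -> : 2 * k.+1%:R^-1 = (2^-1 * k.+1%:R)^-1 :> R by rewrite invfM invrK.
  by rewrite lef_pV2 ?posrE// mulr_gt0.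
have o1 : 0 <= (om k)^-1 by rewrite invr_ge0 ltW.
have h1 := sqr_ge0 (`|c k| - (om k)^-1).
have h2 : (om k)^-1 ^+ 2 <= (2 * k.+1%:R^-1) ^+ 2 by rewrite lerXn2r ?nnegrE//; lra.
have h3 : 0 <= `|c k| * (om k)^-1 by rewrite mulr_ge0.
have e1 : (2 * k.+1%:R^-1) ^+ 2 = 4 * k.+1%:R ^- 2 :> R.
  by rewrite exprMn exprVn; congr (_ * _); ring.
have e2 : `|c k| ^+ 2 = c k ^+ 2 by rewrite real_normK ?num_real.
have e3 : (`|c k| - (om k)^-1) ^+ 2 =
    `|c k| ^+ 2 - 2 * (`|c k| * (om k)^-1) + (om k)^-1 ^+ 2 by ring.
rewrite e1 in h2; rewrite e3 e2 in h1.
move: h1 h2 h3; move: (c k ^+ 2) (`|c k| * _) ((om k)^-1 ^+ 2) (4 * _).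
by move=> A B E F h1 h2 h3; lra.
Qed.

(** The constant mode k = 0 has another norm than the remaining cosines, so Bessel's inequality is
    applied from k = 1 on. *)
Lemma fcoef1_sqr_cvg (g : R -> R) : square_integrable g ->
  cvgn (series (fun k => fcoef1 g k ^+ 2)).
Proof.
move=> hg; apply: cvg_series_shift.
have e1 : 2 * 1 = 2%:R :> R by rewrite mulr1.
have := bessel_swave (c := 1) (th := pi / 2) e1 hg.
suff -> : (fun k => fcoef1 g k.+1 ^+ 2) = (fun k =>
   (pi^-1 * \int[mu]_(x in D) (g x * swave (k%:R + 1) (pi / 2) x)) ^+ 2) by [].
apply/funext => k; congr ((_ * _) ^+ 2).
by apply: eq_Rintegral => x _; rewrite swave_cos natr1.
Qed.

Lemma fcoef2_sqr_cvg (g : R -> R) : square_integrable g ->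
  cvgn (series (fun k => fcoef2 g k ^+ 2)).
Proof.
move=> hg.
have e1 : 2 * 2^-1 = 1%:R :> R by rewrite divff.
have := bessel_swave (c := 0) (th := 0) e1 hg.
suff -> : (fun k => fcoef2 g k ^+ 2) = (fun k =>
   (pi^-1 * \int[mu]_(x in D) (g x * swave (k%:R + 2^-1) 0 x)) ^+ 2) by [].
apply/funext => k; congr ((_ * _) ^+ 2).
by apply: eq_Rintegral => x _; rewrite swave_sin.
Qed.

Lemma cvg_series_sqrB (p q : nat -> R) :
  cvgn (series (fun k => p k ^+ 2)) -> cvgn (series (fun k => q k ^+ 2)) ->
  cvgn (series (fun k => (p k - q k) ^+ 2)).
Proof.
move=> cp cq.
have cM : cvgn (series (fun k => 2 * p k ^+ 2 + 2 * q k ^+ 2)).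
  have -> : series (fun k => 2 * p k ^+ 2 + 2 * q k ^+ 2) =
     (fun n => 2 * series (fun k => p k ^+ 2) n + 2 * series (fun k => q k ^+ 2) n).
    by apply/funext => n; rewrite /series/= !mulr_sumr -big_split.
  by apply: is_cvgD; apply: is_cvgM => //; exact: is_cvg_cst.
apply: cvg_series_dominated cM _ => k.
rewrite ger0_norm ?sqr_ge0//; have := sqr_ge0 (p k + q k).
by rewrite sqrrB sqrrD !mulr2n; lra.
Qed.

Lemma lim_seriesZ (s : R) (u v : nat -> R) : cvgn (series u) ->
  (forall k, v k = s * u k) -> limn (series v) = s * limn (series u).
Proof.
move=> cu vE; apply/(@cvg_lim R) => //.
have -> : series v = fun n => s * series u n.
  by apply/funext => n; rewrite /series/= mulr_sumr; apply: eq_bigr.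
by apply: cvgM; [exact: cvg_cst|exact: cu].
Qed.

Lemma lim_series0 (u : nat -> R) : (forall k, u k = 0) -> limn (series u) = 0.
Proof.
move=> u0; have -> : series u = fun=> 0.
  by apply/funext => n; rewrite /series/= big1.
exact: lim_cst.
Qed.

Lemma psum1_series (a : nat -> R) : a 0%N = 0 -> psum1 a = series a.
Proof.
move=> a0; apply/funext => -[|n]; first by rewrite /psum1 /series/= !big_geq.
by rewrite /psum1 /series/= [RHS]big_ltn// a0 add0r.
Qed.

Lemma within_Omega_continuous (T : R) (A : set (R * R)) (F : R * R -> R) p :
  Omega T `<=` A -> {within A, continuous F} -> Omega T p -> {for p, continuous F}.
Proof.
move=> OA cF Op; have := continuous_subspaceW OA cF.
rewrite continuous_open_subspace; last exact: open_Omega.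
by apply; exact: mem_set.
Qed.

End Coefficients.

(** * Assembly of the solution from its two mode series *)

Section Solution.
Context {R : realType}.
Notation mu := (@lebesgue_measure R).
Notation D := (`[- pi, (pi : R)]%classic).
Variables (T eps : R).
Variables (phi phi1 phi2 phi3 psi psi1 psi2 psi3 : R -> R).
Hypotheses (T0 : 0 < T) (eps1 : `|eps| < 1).
Hypotheses (phiC : C2_on (- pi) pi phi phi1 phi2)
  (phiL : deriv_L2 (- pi) pi phi2 phi3).
Hypotheses (psiC : C2_on (- pi) pi psi psi1 psi2)
  (psiL : deriv_L2 (- pi) pi psi2 psi3).
Hypotheses (phim : phi (- pi) = 0) (phip : phi pi = 0).
Hypotheses (phi2m : phi2 (- pi) = 0) (phi2p : phi2 pi = 0).
Hypotheses (psim : psi (- pi) = 0) (psip : psi pi = 0).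
Hypotheses (psi2m : psi2 (- pi) = 0) (psi2p : psi2 pi = 0).

Let ltpi : - pi < (pi : R).
Proof. by have p0 := pi_gt0 R; lra. Qed.

Let c1 k := fcoef1 phi3 k - fcoef1 psi3 k.
Let c2 k := fcoef2 phi3 k - fcoef2 psi3 k.
Let om1 (k : nat) : R := k%:R.
Let om2 (k : nat) : R := k%:R + 2^-1.
Let d1 k := c1 k / om1 k ^+ 3.
Let d2 k := c2 k / om2 k ^+ 3.

Let a1 : 0 < 1 + eps.
Proof. by move: eps1; rewrite ltr_norml => /andP[? ?]; lra. Qed.

Let a2 : 0 < 1 - eps.
Proof. by move: eps1; rewrite ltr_norml => /andP[? ?]; lra. Qed.

Let sqphi3 : square_integrable phi3.
Proof. by case: phiL => ? []. Qed.

Let sqpsi3 : square_integrable psi3.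
Proof. by case: psiL => ? []. Qed.

Let om1E k : 2^-1 * k.+1%:R <= om1 k \/ om1 k = 0.
Proof.
case: k => [|k]; first by right.
by left; rewrite /om1 -(natr1 k.+1) -(natr1 k); have := ler0n R k; lra.
Qed.

Let om2E k : 2^-1 * k.+1%:R <= om2 k \/ om2 k = 0.
Proof. by left; rewrite /om2 -(natr1 k); have := ler0n R k; lra. Qed.

Let h1 k : 2^-1 <= om1 k \/ d1 k = 0.
Proof.
case: k => [|k]; first by right; rewrite /d1 /om1 expr0n/= invr0 mulr0.
by left; rewrite /om1 -(natr1 k); have := ler0n R k; lra.
Qed.

Let h2 k : 2^-1 <= om2 k \/ d2 k = 0.
Proof. by left; rewrite /om2; have := ler0n R k; lra. Qed.

Let cv1 : cvgn (series (fun k => om1 k ^+ 2 * `|d1 k|)).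
Proof.
apply: cvg_mode_coefs om1E.
by apply: cvg_series_sqrB; exact: fcoef1_sqr_cvg.
Qed.

Let cv2 : cvgn (series (fun k => om2 k ^+ 2 * `|d2 k|)).
Proof.
apply: cvg_mode_coefs om2E.
by apply: cvg_series_sqrB; exact: fcoef2_sqr_cvg.
Qed.

Let u1 := mode_u (1 + eps) T 0 om1 d1.
Let u2 := mode_u (1 - eps) T (pi / 2) om2 d2.
Let f1 := mode_f (1 + eps) T 0 om1 d1.
Let f2 := mode_f (1 - eps) T (pi / 2) om2 d2.

Let u_term1E x t :
  psum1 (u_term1 T eps (fcoef1 phi3) (fcoef1 psi3) x t) = series (u1 x t).
Proof.
rewrite psum1_series; last by rewrite /u_term1 mul0r sin0 mulr0.
by congr series; apply/funext => k; rewrite /u1 /mode_u addr0.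
Qed.

Let u_term2E x t :
  psum0 (u_term2 T eps (fcoef2 phi3) (fcoef2 psi3) x t) = series (u2 x t).
Proof.
rewrite /psum0 /series; apply/funext => n; apply: eq_bigr => k _.
by rewrite /u2 /mode_u sinDpihalf.
Qed.

Let f_term1E x :
  psum1 (f_term1 T eps (fcoef1 phi3) (fcoef1 psi3) x) = series (f1 x).
Proof.
rewrite psum1_series; last by rewrite /f_term1 mul0r sin0 mulr0.
congr series; apply/funext => -[|k].
  by rewrite /f1 /f_term1 /mode_f /om1 !mul0r addr0 sin0 !mulr0.
rewrite /f1 /f_term1 /mode_f /d1 /om1 /c1 addr0 /lam1.
have k0 : k.+1%:R != 0 :> R by rewrite pnatr_eq0.
move: ((1 - expR _)^-1) => q; move: (fcoef1 phi3 _ - _) (sin _) => w z.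
by field.
Qed.

Let f_term2E x :
  psum0 (f_term2 T eps (fcoef2 phi3) (fcoef2 psi3) x) = series (f2 x).
Proof.
rewrite /psum0 /series; apply/funext => n; apply: eq_bigr => k _.
rewrite /f2 /f_term2 /mode_f /d2 /om2 /c2 sinDpihalf /lam2.
have k0 : k%:R + 2^-1 != 0 :> R by rewrite gt_eqF// ltr_wpDl.
move: k0; move: (k%:R + 2^-1) => o o0.
move: ((1 - expR _)^-1) => q; move: (fcoef2 phi3 _ - _) (cos _) => w z.
by field.
Qed.

Let sin1pi k : swave (om1 k) 0 pi = 0 /\ swave (om1 k) 0 (- pi) = 0.
Proof. by rewrite !swave_sin mulrN sinN sin_natpi oppr0. Qed.

Let cos2pi_half k : cos (om2 k * pi) = 0 :> R.
Proof.
have -> : om2 k * pi = k%:R * pi + pi / 2 :> R by rewrite /om2; ring.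
by rewrite cosDpihalf sin_natpi oppr0.
Qed.

Let sin2pi k : swave (om2 k) (pi / 2) pi = 0 /\ swave (om2 k) (pi / 2) (- pi) = 0.
Proof. by rewrite !swave_cos mulrN cosN cos2pi_half. Qed.

Let fcoef1E k (g g1 g2 g3 : R -> R) :
  C2_on (- pi) pi g g1 g2 -> deriv_L2 (- pi) pi g2 g3 ->
  g (- pi) = 0 -> g pi = 0 -> g2 (- pi) = 0 -> g2 pi = 0 ->
  fcoef1 g3 k = - om1 k ^+ 3 * (pi^-1 * scoef g k).
Proof.
move=> gC gL gm gp g2m g2p; have [sp sm] := sin1pi k.
rewrite mulrCA -(third_derivative_coef sp sm gC gL)//.
by congr (_ * _); apply: eq_Rintegral => x _; rewrite addr0.
Qed.

(** In this family cos(w x + pi/2) = - sin(w x), which reverses the sign found in [fcoef1E]. This is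
    the origin of the minus sign before the second series of the formula. *)
Let fcoef2E k (g g1 g2 g3 : R -> R) :
  C2_on (- pi) pi g g1 g2 -> deriv_L2 (- pi) pi g2 g3 ->
  g (- pi) = 0 -> g pi = 0 -> g2 (- pi) = 0 -> g2 pi = 0 ->
  fcoef2 g3 k = om2 k ^+ 3 * (pi^-1 * ccoef g k).
Proof.
move=> gC gL gm gp g2m g2p; have [sp sm] := sin2pi k.
rewrite mulrCA; congr (_ * _).
have g3i : rintegrable D g3.
  by apply: square_integrable_integrable; case: gL => ? [].
have := third_derivative_coef sp sm gC gL gm gp g2m g2p.
rewrite mulNr => /(congr1 -%R); rewrite opprK => <-.
have -> : \int[mu]_(x in D) (g3 x * sin (om2 k * x)) =
    \int[mu]_(x in D) (-1 * (g3 x * cos (om2 k * x + pi / 2))).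
  by apply: eq_Rintegral => x _; rewrite cosDpihalf mulN1r mulrN opprK.
rewrite RintegralZl// ?mulN1r//.
have -> : EFin \o (fun x => g3 x * cos (om2 k * x + pi / 2)) =
    EFin \o (fun x => g3 x * swave (om2 k) pi x).
  by apply/funext => x; rewrite /= cosDpihalf /swave sinDpi.
exact: rintegrable_swave.
Qed.

Let fourier_partial x n :
  series (fun k => d1 k * sin (om1 k * x + 0)) n.+1 -
  series (fun k => d2 k * sin (om2 k * x + pi / 2)) n.+1 =
  - (pi^-1 * fourier_sum (fun y => phi y - psi y) x n).
Proof.
have [_ [cphi _]] := phiC; have [_ [cpsi _]] := psiC.
have iphi : rintegrable D phi by exact: continuous_rintegrable.
have ipsi : rintegrable D psi by exact: continuous_rintegrable.
rewrite fourier_sumB// mulrBr /fourier_sum /series/= !mulrDr !mulr_sumr.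
have -> : forall a b c e : R, - (a + b - (c + e)) = (c - a) - (b - e).
  by move=> *; ring.
congr (_ - _); rewrite -sumrB; apply: eq_bigr => k _.
- rewrite /d1 /c1 (fcoef1E k phiC phiL)// (fcoef1E k psiC psiL)// addr0.
  case: k => [|k]; first by rewrite /om1 mul0r sin0 !mulr0 subr0.
  have k0 : k.+1%:R != 0 :> R by rewrite pnatr_eq0.
  rewrite /om1; move: (pi^-1) => p; move: (scoef phi _) (scoef psi _) (sin _).
  by move=> A B S; field.
- rewrite /d2 /c2 (fcoef2E k phiC phiL)// (fcoef2E k psiC psiL)// sinDpihalf.
  rewrite /om2; have k0 : k%:R + 2^-1 != 0 :> R by rewrite gt_eqF// ltr_wpDl.
  move: (pi^-1) => p; move: (ccoef phi _) (ccoef psi _) (cos _).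
  move: k0; move: (k%:R + 2^-1) => o o0.
  by move=> A B S; field.
Qed.

(** Inside the interval the difference of the two series is the limit of their jointly truncated
    partial sums, which are Fourier sums of phi - psi up to sign. At the end points all modes
    vanish, as do [phi] and [psi]. *)
Let final_value x : - pi <= x <= pi ->
  limn (series (u1 x T)) - limn (series (u2 x T)) = psi x - phi x.
Proof.
move=> xpi.
have TT : 0 <= T <= T by rewrite lexx ltW.
rewrite /u1 /u2 (mode_uT _ a1 T0 h1) (mode_uT _ a2 T0 h2).
have edge : limn (series (fun k => d1 k * sin (om1 k * x + 0))) = 0 ->
    limn (series (fun k => d2 k * sin (om2 k * x + pi / 2))) = 0 ->
    psi x - phi x = 0 ->
    limn (series (fun k => d1 k * sin (om1 k * x + 0))) -
    limn (series (fun k => d2 k * sin (om2 k * x + pi / 2))) = psi x - phi x.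
  by move=> -> -> ->; rewrite subrr.
have [xp|xNp] := eqVneq x pi.
  rewrite xp in edge *; apply: edge.
  - by apply: lim_series0 => k; have [e _] := sin1pi k; rewrite -/(swave _ _ _) e mulr0.
  - by apply: lim_series0 => k; have [e _] := sin2pi k; rewrite -/(swave _ _ _) e mulr0.
  - by rewrite phip psip subrr.
have [xm|xNm] := eqVneq x (- pi).
  rewrite xm in edge *; apply: edge.
  - by apply: lim_series0 => k; have [_ e] := sin1pi k; rewrite -/(swave _ _ _) e mulr0.
  - by apply: lim_series0 => k; have [_ e] := sin2pi k; rewrite -/(swave _ _ _) e mulr0.
  - by rewrite phim psim subrr.
have {}xpi : - pi < x < pi.
  by case/andP: xpi => ? ?; rewrite !lt_neqAle xNp eq_sym xNm; apply/andP.
have [dphi [cphi _]] := phiC; have [dpsi [cpsi _]] := psiC.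
pose g y := phi y - psi y.
have cg : {within D, continuous g}.
  by move=> y; apply: cvgB; [exact: cphi|exact: cpsi].
have dg : is_derive x 1 g (phi1 x - psi1 x).
  by apply: is_deriveB; [have [] := dphi x xpi|have [] := dpsi x xpi].
have pw := fourier_pointwise xpi cg dg.
have s1 : cvgn (series (fun k => d1 k * sin (om1 k * x + 0))).
  by have := cvg_mode_u (th := 0) (x := x) a1 T0 h1 cv1 TT; rewrite (mode_uT _ a1 T0 h1).
have s2 : cvgn (series (fun k => d2 k * sin (om2 k * x + pi / 2))).
  have := cvg_mode_u (th := pi / 2) (x := x) a2 T0 h2 cv2 TT.
  by rewrite (mode_uT _ a2 T0 h2).
have L : series (fun k => d1 k * sin (om1 k * x + 0)) n.+1 -
    series (fun k => d2 k * sin (om2 k * x + pi / 2)) n.+1 @[n --> \oo] -->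
    limn (series (fun k => d1 k * sin (om1 k * x + 0))) -
    limn (series (fun k => d2 k * sin (om2 k * x + pi / 2))).
  by apply: cvgB; rewrite cvg_shiftS; [exact: s1|exact: s2].
have L2 : series (fun k => d1 k * sin (om1 k * x + 0)) n.+1 -
    series (fun k => d2 k * sin (om2 k * x + pi / 2)) n.+1 @[n --> \oo] -->
    - g x.
  under eq_fun do rewrite fourier_partial.
  by apply: cvgN; exact: pw.
rewrite (@cvg_unique _ (@norm_hausdorff _ _) _ _ _ _ L L2) /g.
by rewrite opprB.
Qed.

Let interior_continuous (g : R -> R) (x : R) : {within D, continuous g} ->
  - pi < x < pi -> {for x, continuous g}.
Proof.
move=> /(continuous_within_itvP g ltpi)[cg _ _] xpi.
by apply: cg; rewrite in_itv.
Qed.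

(** The sine part is odd in x and the cosine part even, so - uxx(x) + eps uxx(-x) acts as -(1 + eps)
    uxx on the former and as -(1 - eps) uxx on the latter. These are the diffusivities built into
    the two mode series. *)
Let reflect_uxx1 x t : 0 <= t <= T ->
  limn (series (mode_uxx (1 + eps) T 0 om1 d1 (- x) t)) =
  - limn (series (mode_uxx (1 + eps) T 0 om1 d1 x t)).
Proof.
move=> tT; rewrite -[RHS]mulN1r; apply: lim_seriesZ.
  exact: (cvg_mode_uxx a1 T0 h1 cv1).
move=> k; rewrite /mode_uxx.
have -> : om1 k * - x + 0 = - (om1 k * x + 0) by ring.
by rewrite sinN; ring.
Qed.

Let reflect_uxx2 x t : 0 <= t <= T ->
  limn (series (mode_uxx (1 - eps) T (pi / 2) om2 d2 (- x) t)) =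
  limn (series (mode_uxx (1 - eps) T (pi / 2) om2 d2 x t)).
Proof.
move=> tT; rewrite -[RHS]mul1r; apply: lim_seriesZ.
  exact: (cvg_mode_uxx a2 T0 h2 cv2).
move=> k; rewrite /mode_uxx !sinDpihalf.
have -> : om2 k * - x = - (om2 k * x) by ring.
by rewrite cosN mul1r.
Qed.

Definition sol_u x t := phi x + limn (series (u1 x t)) - limn (series (u2 x t)).
Definition sol_f x := - phi2 x + eps * phi2 (- x) + limn (series (f1 x))
  - limn (series (f2 x)).

Let edge_value x t : (forall k, swave (om1 k) 0 x = 0) ->
  (forall k, swave (om2 k) (pi / 2) x = 0) -> phi x = 0 -> sol_u x t = 0.
Proof.
move=> e1 e2 px; rewrite /sol_u px.
rewrite (lim_series0 (u := u1 x t)); last first.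
  by move=> k; rewrite /u1 /mode_u -/(swave _ _ _) e1 mulr0.
rewrite (lim_series0 (u := u2 x t)); last first.
  by move=> k; rewrite /u2 /mode_u -/(swave _ _ _) e2 mulr0.
by rewrite addr0 subr0.
Qed.

Lemma sol_regular : regular_solution T eps phi psi sol_u sol_f.
Proof.
have [dphi [cphi [cphi1 cphi2]]] := phiC.
exists (fun x t => phi1 x + limn (series (mode_ux (1 + eps) T 0 om1 d1 x t)) -
  limn (series (mode_ux (1 - eps) T (pi / 2) om2 d2 x t))).
exists (fun x t => phi2 x + limn (series (mode_uxx (1 + eps) T 0 om1 d1 x t)) -
  limn (series (mode_uxx (1 - eps) T (pi / 2) om2 d2 x t))).
(* The summand 0 is the time derivative of the term phi(x). *)
exists (fun x t => 0 + limn (series (mode_ut (1 + eps) T 0 om1 d1 x t)) -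
  limn (series (mode_ut (1 - eps) T (pi / 2) om2 d2 x t))).
have strip : Omega T `<=` [set q : R * R | 0 <= q.2 <= T].
  by move=> q [_ /andP[? ?]] /=; rewrite !ltW.
split; [split|split; [|split; [|split; [|split]]]].
- move=> x t [/= xpi tT]; have tT' : 0 <= t <= T.
    by case/andP: tT => ? ?; rewrite !ltW.
  have [e1 e2] := dphi x xpi; rewrite /sol_u /u1 /u2.
  split; [|split].
  + apply: is_deriveB; last exact: (is_derive_mode_ux (pi / 2) a2 T0 h2 cv2 x tT').
    by apply: is_deriveD; exact: (is_derive_mode_ux 0 a1 T0 h1 cv1 x tT').
  + apply: is_deriveB; last exact: (is_derive_mode_uxx (pi / 2) a2 T0 h2 cv2 x tT').
    by apply: is_deriveD; exact: (is_derive_mode_uxx 0 a1 T0 h1 cv1 x tT').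
  + apply: is_deriveB; last exact: (is_derive_mode_ut (pi / 2) a2 T0 h2 cv2 x tT).
    by apply: is_deriveD; exact: (is_derive_mode_ut 0 a1 T0 h1 cv1 x tT).
- move=> [x t] Op; have [/= xpi tT] := Op.
  have cfst (g : R -> R) : {within D, continuous g} ->
      {for (x, t), continuous (fun q : R * R => g q.1)}.
    move=> cg; apply: (@continuous_comp _ _ _ fst g); first exact: cvg_fst.
    exact: interior_continuous.
  split; [|split; [|split]].
  + apply: cvgB; [apply: cvgD; first exact: (cfst phi)|].
      exact: (within_Omega_continuous strip (continuous_mode_u a1 T0 h1 cv1) Op).
    exact: (within_Omega_continuous strip (continuous_mode_u a2 T0 h2 cv2) Op).
  + apply: cvgB; [apply: cvgD; first exact: (cfst phi1)|].
      exact: (within_Omega_continuous strip (continuous_mode_ux a1 T0 h1 cv1) Op).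
    exact: (within_Omega_continuous strip (continuous_mode_ux a2 T0 h2 cv2) Op).
  + apply: cvgB; [apply: cvgD; first exact: (cfst phi2)|].
      exact: (within_Omega_continuous strip (continuous_mode_uxx a1 T0 h1 cv1) Op).
    exact: (within_Omega_continuous strip (continuous_mode_uxx a2 T0 h2 cv2) Op).
  + apply: cvgB; [apply: cvgD; first exact: cvg_cst|].
      exact: (within_Omega_continuous strip (continuous_mode_ut a1 T0 h1 cv1) Op).
    exact: (within_Omega_continuous strip (continuous_mode_ut a2 T0 h2 cv2) Op).
- have strip' : Omega_bar T `<=` [set q : R * R | 0 <= q.2 <= T] by move=> q [].
  have k1 := continuous_subspaceW strip' (continuous_mode_u (th := 0) a1 T0 h1 cv1).
  have k2 := continuous_subspaceW strip'
    (continuous_mode_u (th := pi / 2) a2 T0 h2 cv2).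
  have k3 : {within Omega_bar T, continuous (fun q : R * R => phi q.1)}.
    apply: (@within_continuous_comp_map _ _ _ _ _ phi fst _ _ cphi).
      by move=> q; exact: cvg_fst.
    by move=> q [? _] /=; rewrite in_itv.
  by move=> q; apply: cvgB; [apply: cvgD; [exact: k3|exact: k1]|exact: k2].
- have k1 := continuous_subspaceT (A := D) (continuous_mode_f (th := 0) a1 T0 h1 cv1).
  have k2 := continuous_subspaceT (A := D)
    (continuous_mode_f (th := pi / 2) a2 T0 h2 cv2).
  have k3 : {within D, continuous (fun x => phi2 (- x))}.
    apply: (@within_continuous_comp_map _ _ _ _ _ phi2 -%R _ _ cphi2).
      by move=> q; apply: cvgN; exact: cvg_id.
    by move=> x /=; rewrite !in_itv/= => /andP[? ?]; apply/andP; split; lra.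
  move=> x; apply: cvgB; last exact: k2.
  apply: cvgD; last exact: k1.
  apply: cvgD; first by apply: cvgN; exact: cphi2.
  by apply: cvgM; [exact: cvg_cst|exact: k3].
- move=> x t [/= xpi tT]; have tT' : 0 <= t <= T.
    by case/andP: tT => ? ?; rewrite !ltW.
  rewrite (reflect_uxx1 x tT') (reflect_uxx2 x tT') /sol_f.
  have := mode_equation 0 a1 T0 h1 cv1 x tT'.
  have := mode_equation (pi / 2) a2 T0 h2 cv2 x tT'.
  rewrite -/f1 -/f2.
  move: (limn (series (f1 x))) (limn (series (f2 x))) => F1 F2.
  move: (limn (series (mode_ut (1 + eps) _ _ _ _ _ _))) => A1.
  move: (limn (series (mode_ut (1 - eps) _ _ _ _ _ _))) => A2.
  move: (limn (series (mode_uxx (1 + eps) _ _ _ _ _ _))) => B1.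
  move: (limn (series (mode_uxx (1 - eps) _ _ _ _ _ _))) => B2.
  by move=> <- <-; ring.
- move=> x xpi; rewrite /sol_u; split.
    by rewrite /u1 /u2 !mode_u0 addr0 subr0.
  by rewrite -addrA final_value// addrC subrK.
- move=> t tT; split; apply: edge_value => //.
  + by move=> k; have [] := sin1pi k.
  + by move=> k; have [] := sin2pi k.
  + by move=> k; have [] := sin1pi k.
  + by move=> k; have [] := sin2pi k.
Qed.

Lemma sol_uE x t : 0 <= t <= T ->
  cvgn (psum1 (u_term1 T eps (fcoef1 phi3) (fcoef1 psi3) x t)) /\
  cvgn (psum0 (u_term2 T eps (fcoef2 phi3) (fcoef2 psi3) x t)) /\
  sol_u x t = phi x
    + limn (psum1 (u_term1 T eps (fcoef1 phi3) (fcoef1 psi3) x t))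
    - limn (psum0 (u_term2 T eps (fcoef2 phi3) (fcoef2 psi3) x t)).
Proof.
move=> tT; rewrite u_term1E u_term2E; split; [|split] => //.
  exact: (cvg_mode_u a1 T0 h1 cv1).
exact: (cvg_mode_u a2 T0 h2 cv2).
Qed.

Lemma sol_fE x :
  cvgn (psum1 (f_term1 T eps (fcoef1 phi3) (fcoef1 psi3) x)) /\
  cvgn (psum0 (f_term2 T eps (fcoef2 phi3) (fcoef2 psi3) x)) /\
  sol_f x = - phi2 x + eps * phi2 (- x)
    + limn (psum1 (f_term1 T eps (fcoef1 phi3) (fcoef1 psi3) x))
    - limn (psum0 (f_term2 T eps (fcoef2 phi3) (fcoef2 psi3) x)).
Proof.
rewrite f_term1E f_term2E; split; [|split] => //.
  exact: (cvg_mode_f a1 T0 h1 cv1).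
exact: (cvg_mode_f a2 T0 h2 cv2).
Qed.

End Solution.

Unset Implicit Arguments.
Set Strict Implicit.
Set Printing Implicit Defensive.

Theorem theorem1 (R : realType) (T eps : R)
    (phi phi1 phi2 phi3 psi psi1 psi2 psi3 : R -> R) :
  0 < T -> eps != 0 -> `|eps| < 1 ->
  C2_on (- pi) pi phi phi1 phi2 -> deriv_L2 (- pi) pi phi2 phi3 ->
  C2_on (- pi) pi psi psi1 psi2 -> deriv_L2 (- pi) pi psi2 psi3 ->
  phi (- pi) = 0 -> phi pi = 0 -> phi2 (- pi) = 0 -> phi2 pi = 0 ->
  psi (- pi) = 0 -> psi pi = 0 -> psi2 (- pi) = 0 -> psi2 pi = 0 ->
  (exists (u : R -> R -> R) (f : R -> R), regular_solution T eps phi psi u f) /\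
  (forall (u : R -> R -> R) (f : R -> R), regular_solution T eps phi psi u f ->
     (forall x t, Omega_bar T (x, t) ->
        cvgn (psum1 (u_term1 T eps (fcoef1 phi3) (fcoef1 psi3) x t)) /\
        cvgn (psum0 (u_term2 T eps (fcoef2 phi3) (fcoef2 psi3) x t)) /\
        u x t = phi x
                + limn (psum1 (u_term1 T eps (fcoef1 phi3) (fcoef1 psi3) x t))
                - limn (psum0 (u_term2 T eps (fcoef2 phi3) (fcoef2 psi3) x t))) /\
     (forall x, -pi <= x <= pi ->
        cvgn (psum1 (f_term1 T eps (fcoef1 phi3) (fcoef1 psi3) x)) /\
        cvgn (psum0 (f_term2 T eps (fcoef2 phi3) (fcoef2 psi3) x)) /\
        f x = - phi2 x + eps * phi2 (- x)
              + limn (psum1 (f_term1 T eps (fcoef1 phi3) (fcoef1 psi3) x))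
              - limn (psum0 (f_term2 T eps (fcoef2 phi3) (fcoef2 psi3) x)))).
Proof.
move=> T0 _ eps1 phiC phiL psiC psiL *.
have reg : regular_solution T eps phi psi (sol_u T eps phi phi3 psi3)
    (sol_f T eps phi2 phi3 psi3).
  by apply: (@sol_regular R T eps phi phi1 phi2 phi3 psi psi1 psi2 psi3).
split; first by exists (sol_u T eps phi phi3 psi3), (sol_f T eps phi2 phi3 psi3).
(* An arbitrary regular solution agrees with the constructed one and so inherits its series. *)
move=> u f uf; have [uE fE] := regular_solution_unique T0 eps1 uf reg.
split=> [x t Oxt|x xpi].
- rewrite (uE x t Oxt); case: Oxt => _ tT.
  exact: (sol_uE phi T0 eps1 phiL psiL x tT).
- rewrite (fE x xpi).
  exact: (sol_fE T0 eps1 phiL psiL x).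
Qed.
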